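(* Assume that $S(t)$ has a compact global attractor $\mathcal A$ and that, for all sufficiently small $\varepsilon>0$, $S_\varepsilon(t)$ has a compact global attractor $\mathcal A_\varepsilon$. For small $\varepsilon$ let $$\eta_\varepsilon=\sup_{u\in\mathcal A\cup\mathcal A_\varepsilon}\ \sup_{t\ge0}\|R_\varepsilon S(t)u-S_\varepsilon^{\mathcal M}(t)R_\varepsilon u\|_{\mathcal H},$$ and suppose $\eta_\varepsilon\le C_0\varepsilon^2$ with $C_0$ independent of $\varepsilon$. Then, with $d_\varepsilon=M/\lambda_\varepsilon^++M/\alpha_\varepsilon$, $$d_{H,\mathcal H}(\mathcal A_\varepsilon,\mathcal A)\le\eta_\varepsilon+d_\varepsilon\le\Bigl(C_0+\frac{2M}{\mu}\Bigr)\varepsilon^2 .$$ In particular, the conclusion (for some $C_0$ independent of $\varepsilon$) holds if these global attractors exist and there are $\varepsilon_0\in(0,1]$ and $\sigma>0$ such that for every $0<\varepsilon\le\varepsilon_0$, all $p_1,p_2\in P_\varepsilon\mathcal H$ and all $q\in Q_\varepsilon\mathcal H$, $$\bigl\langle A(p_1-p_2)-P_\varepsilon\bigl(F(p_1+q)-F(p_2+q)\bigr),\,p_1-p_2\bigr\rangle_{\mathcal H}\ge\sigma\|p_1-p_2\|_{\mathcal H}^2 .$$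
   Context: $\mathcal H$ is an infinite-dimensional real Hilbert space and $A:\mathrm D(A)\subset\mathcal H\to\mathcal H$ is a nonnegative self-adjoint operator with compact resolvent. The map $F:\mathcal H\to\mathcal H$ satisfies, for constants $M,L>0$, $\|F(u)\|_{\mathcal H}\le M$ and $\|F(u)-F(w)\|_{\mathcal H}\le L\|u-w\|_{\mathcal H}$ for all $u,w\in\mathcal H$. Fix $\mu>0$. For $0<\varepsilon\le1$ let $\Lambda_\varepsilon=\mu\varepsilon^{-2}$, $P_\varepsilon=\mathbf 1_{[0,\Lambda_\varepsilon]}(A)$, $Q_\varepsilon=I-P_\varepsilon$, $A_\varepsilon=A+\varepsilon^{-1}Q_\varepsilon$ with $\mathrm D(A_\varepsilon)=\mathrm D(A)$. Put $\beta_\varepsilon=\sup\sigma(A|_{P_\varepsilon\mathcal H})$ ($=0$ if $P_\varepsilon\mathcal H=\{0\}$), $\lambda_\varepsilon^+=\inf\sigma(A|_{Q_\varepsilon\mathcal H})$, $\alpha_\varepsilon=\lambda_\varepsilon^++\varepsilon^{-1}$, $\gamma_\varepsilon=\alpha_\varepsilon-\beta_\varepsilon\ge\varepsilon^{-1}$. $S(t)$ and $S_\varepsilon(t)$ are the semiflows on $\mathcal H$ of global mild solutions of $\dot v+Av=F(v)$ and $\dot v^\varepsilon+A_\varepsilon v^\varepsilon=F(v^\varepsilon)$, respectively. Whenever $\gamma_\varepsilon\ge8L$ (true for all small $\varepsilon$), $\mathcal M_\varepsilon=\{p+h_\varepsilon(p):p\in P_\varepsilon\mathcal H\}$ denotes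 the inertial manifold of $S_\varepsilon(t)$ given by classical theory, with $h_\varepsilon:P_\varepsilon\mathcal H\to Q_\varepsilon\mathcal H$, $\|h_\varepsilon\|_{L^\infty}\le M/\alpha_\varepsilon$, $\operatorname{Lip}(h_\varepsilon)\le4L/\gamma_\varepsilon$, $S_\varepsilon(t)\mathcal M_\varepsilon=\mathcal M_\varepsilon$ for $t\ge0$, and dynamics on $\mathcal M_\varepsilon$ governed by $\dot p+Ap=P_\varepsilon F(p+h_\varepsilon(p))$; it contains the global attractor of $S_\varepsilon(t)$ whenever the latter exists. Write $S_\varepsilon^{\mathcal M}(t)=S_\varepsilon(t)|_{\mathcal M_\varepsilon}$ and define $R_\varepsilon:\mathcal H\to\mathcal M_\varepsilon$, $R_\varepsilon u=P_\varepsilon u+h_\varepsilon(P_\varepsilon u)$. For nonempty $B,C\subset\mathcal H$: $\operatorname{dist}_{\mathcal H}(B,C)=\sup_{b\in B}\inf_{c\in C}\|b-c\|_{\mathcal H}$ and $d_{H,\mathcal H}(B,C)=\max\{\operatorname{dist}_{\mathcal H}(B,C),\operatorname{dist}_{\mathcal H}(C,B)\}$. *)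

(* Defs.v *)
From Stdlib Require Import Reals List.
From Coquelicot Require Import Coquelicot.
Open Scope R_scope.

(** * Real Hilbert spaces *)

Record HilbertSpace := {
  hilbert_carrier :> CompleteNormedModule R_AbsRing;
  inner : hilbert_carrier -> hilbert_carrier -> R;
  inner_sym : forall u v, inner u v = inner v u;
  inner_plus_l : forall u v w, inner (plus u v) w = inner u w + inner v w;
  inner_scal_l : forall (a : R) u v, inner (scal a u) v = a * inner u v;
  inner_ge_0 : forall u, 0 <= inner u u;
  norm_inner : forall u : hilbert_carrier, norm u = sqrt (inner u u)
}.
Arguments inner {h} _ _.

Definition span {H : HilbertSpace} (E : H -> Prop) (u : H) : Prop :=
  exists (n : nat) (c : nat -> R) (e : nat -> H),
    (forall k, E (e k)) /\ u = sum_n (fun k => scal (c k) (e k)) n.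

Definition closed_span {H : HilbertSpace} (E : H -> Prop) (u : H) : Prop :=
  forall r : R, 0 < r -> exists v, span E v /\ norm (minus u v) < r.

Definition infinite_dimensional (H : HilbertSpace) : Prop :=
  ~ exists (n : nat) (e : nat -> H), forall u : H,
      exists c : nat -> R, u = sum_n (fun k => scal (c k) (e k)) n.

Definition range {H : HilbertSpace} (P : H -> H) (u : H) : Prop :=
  exists v, u = P v.

Definition bounded_set {H : HilbertSpace} (B : H -> Prop) : Prop :=
  exists r : R, forall u, B u -> norm u <= r.

Definition compact_set {H : HilbertSpace} (K : H -> Prop) : Prop :=
  forall (I : Type) (U : I -> H -> Prop),
    (forall i, open (U i)) ->
    (forall x, K x -> exists i, U i x) ->
    exists l : list I, forall x, K x -> exists i, In i l /\ U i x.

(** * Unbounded operators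

    An operator is a domain [D] together with a total function [A] whose
    values outside [D] are irrelevant. *)

Record linear_operator {H : HilbertSpace} (D : H -> Prop) (A : H -> H) : Prop := {
  dom_zero : D zero;
  dom_plus : forall u v, D u -> D v -> D (plus u v);
  dom_scal : forall (a : R) u, D u -> D (scal a u);
  op_plus : forall u v, D u -> D v -> A (plus u v) = plus (A u) (A v);
  op_scal : forall (a : R) u, D u -> A (scal a u) = scal a (A u)
}.

Definition dense {H : HilbertSpace} (D : H -> Prop) : Prop :=
  forall (u : H) (r : R), 0 < r -> exists v, D v /\ norm (minus u v) < r.

(* The last clause says that the graphs of A and of its adjoint coincide. *)
Definition self_adjoint {H : HilbertSpace} (D : H -> Prop) (A : H -> H) : Prop :=
  linear_operator D A /\ dense D /\
  forall u w : H,
    (D u /\ A u = w) <-> (forall v, D v -> inner (A v) u = inner v w).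

Definition nonnegative {H : HilbertSpace} (D : H -> Prop) (A : H -> H) : Prop :=
  forall u, D u -> 0 <= inner (A u) u.

(* Coquelicot's [is_linear] includes boundedness. *)
Definition compact_operator {H : HilbertSpace} (K : H -> H) : Prop :=
  is_linear K /\
  exists C : H -> Prop, compact_set C /\ forall f, norm f <= 1 -> C (K f).

Definition compact_resolvent {H : HilbertSpace} (D : H -> Prop) (A : H -> H) : Prop :=
  exists (lam : R) (K : H -> H),
    (forall f, D (K f) /\ minus (A (K f)) (scal lam (K f)) = f) /\
    (forall u, D u -> K (minus (A u) (scal lam u)) = u) /\
    compact_operator K.

(* Resolvent set and spectrum of the restriction of A to the closed subspace X
   (an operator in X with domain the intersection of D and X).  Only real
   spectral values are considered: the restrictions of a self-adjoint operator
   to its spectral subspaces are self-adjoint, hence have real spectrum. *)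
Definition resolvent_set {H : HilbertSpace}
    (X D : H -> Prop) (A : H -> H) (lam : R) : Prop :=
  (forall f, X f -> exists! u, X u /\ D u /\ minus (A u) (scal lam u) = f) /\
  (exists C : R, forall u, X u -> D u ->
     norm u <= C * norm (minus (A u) (scal lam u))).

Definition spectrum {H : HilbertSpace}
    (X D : H -> Prop) (A : H -> H) (lam : R) : Prop :=
  ~ resolvent_set X D A lam.

(* P = 1_{[0,Lam]}(A) for A with compact resolvent: the functional calculus of
   such an operator is given by its eigenvector expansion, so P is the
   orthogonal projection onto the closed span of the eigenvectors with
   eigenvalue in [0,Lam]. *)
Definition low_eigenvector {H : HilbertSpace}
    (D : H -> Prop) (A : H -> H) (Lam : R) (e : H) : Prop :=
  D e /\ exists lam, 0 <= lam <= Lam /\ A e = scal lam e.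

Definition is_spectral_projection {H : HilbertSpace}
    (D : H -> Prop) (A : H -> H) (Lam : R) (P : H -> H) : Prop :=
  forall u,
    closed_span (low_eigenvector D A Lam) (P u) /\
    (forall v, closed_span (low_eigenvector D A Lam) v ->
       inner (minus u (P u)) v = 0).

Definition complement {H : HilbertSpace} (P : H -> H) (u : H) : H :=
  minus u (P u).

(* On the zero space the spectrum is empty and [real m_infty = 0], which is the
   convention beta = 0 in that case. *)
Definition beta {H : HilbertSpace} (D : H -> Prop) (A P : H -> H) : R :=
  real (Lub_Rbar (spectrum (range P) D A)).

Definition lambda_plus {H : HilbertSpace} (D : H -> Prop) (A P : H -> H) : R :=
  real (Glb_Rbar (spectrum (range (complement P)) D A)).

Definition alpha {H : HilbertSpace} (D : H -> Prop) (A P : H -> H) (eps : R) : R :=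
  lambda_plus D A P + / eps.

Definition gamma {H : HilbertSpace} (D : H -> Prop) (A P : H -> H) (eps : R) : R :=
  alpha D A P eps - beta D A P.

Definition damped {H : HilbertSpace} (A P : H -> H) (eps : R) (u : H) : H :=
  plus (A u) (scal (/ eps) (complement P u)).

(** * Semigroups and mild solutions *)

(* T t = exp(-tA): T is the strongly continuous semigroup with generator -A. *)
Record is_exp_semigroup {H : HilbertSpace}
    (D : H -> Prop) (A : H -> H) (T : R -> H -> H) : Prop := {
  sg_linear : forall t, 0 <= t -> is_linear (T t);
  sg_zero : forall u, T 0 u = u;
  sg_plus : forall s t u, 0 <= s -> 0 <= t -> T (s + t) u = T s (T t u);
  sg_cont : forall u, filterlim (fun t => T t u) (at_right 0) (locally u);
  sg_generator : forall u w,
    (D u /\ w = opp (A u)) <->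
    filterlim (fun t => scal (/ t) (minus (T t u) u)) (at_right 0) (locally w)
}.

(* For every u, [fun t => S t u] is the global mild solution on [0,infinity) of
   v' + A v = F(v), v(0) = u, where T t = exp(-tA). *)
Definition is_mild_semiflow {H : HilbertSpace}
    (T : R -> H -> H) (F : H -> H) (S : R -> H -> H) : Prop :=
  forall u,
    (forall t, 0 <= t ->
       filterlim (fun s => S s u) (within (fun s => 0 <= s) (locally t))
                 (locally (S t u))) /\
    (forall t, 0 <= t ->
       is_RInt (fun s => T (t - s) (F (S s u))) 0 t (minus (S t u) (T t u))).

(** * Hausdorff distances and attractors *)

Definition semidist {H : HilbertSpace} (B C : H -> Prop) : Rbar :=
  Lub_Rbar (fun r => exists b, B b /\
    r = real (Glb_Rbar (fun s => exists c, C c /\ s = norm (minus b c)))).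

Definition hausdorff {H : HilbertSpace} (B C : H -> Prop) : Rbar :=
  if Rbar_le_dec (semidist B C) (semidist C B)
  then semidist C B else semidist B C.

Definition image {H : HilbertSpace} (f : H -> H) (B : H -> Prop) (u : H) : Prop :=
  exists b, B b /\ u = f b.

Record is_global_attractor {H : HilbertSpace}
    (S : R -> H -> H) (K : H -> Prop) : Prop := {
  att_nonempty : exists u, K u;
  att_compact : compact_set K;
  att_invariant : forall t, 0 <= t -> forall u, image (S t) K u <-> K u;
  att_attracts : forall B, bounded_set B -> forall r : R, 0 < r ->
    exists t0, forall t, t0 <= t -> 0 <= t ->
      Rbar_lt (semidist (image (S t) B) K) r
}.

(** * Inertial manifolds *)

Definition graph {H : HilbertSpace} (P h : H -> H) (u : H) : Prop :=
  exists p, range P p /\ u = plus p (h p).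

(* [h] is only used on the range of [P]. *)
Record is_inertial_manifold {H : HilbertSpace} (D : H -> Prop) (A F : H -> H)
    (M L eps : R) (P : H -> H) (S : R -> H -> H) (h : H -> H) : Prop := {
  im_range : forall p, range P p -> range (complement P) (h p);
  im_bound : forall p, range P p -> norm (h p) <= M / alpha D A P eps;
  im_lip : forall p1 p2, range P p1 -> range P p2 ->
    norm (minus (h p1) (h p2)) <= 4 * L / gamma D A P eps * norm (minus p1 p2);
  im_invariant : forall t, 0 <= t -> forall u,
    image (S t) (graph P h) u <-> graph P h u;
  im_dynamics : forall u, graph P h u -> forall t, 0 < t ->
    let p := fun s => P (S s u) in
    is_derive p t (minus (P (F (plus (p t) (h (p t))))) (A (p t)));
  im_attractor : forall K, is_global_attractor S K ->
    forall u, K u -> graph P h u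
}.

Definition to_manifold {H : HilbertSpace} (P h : H -> H) (u : H) : H :=
  plus (P u) (h (P u)).

Definition eta {H : HilbertSpace} (P h : H -> H) (S Seps : R -> H -> H)
    (K Keps : H -> Prop) : Rbar :=
  Lub_Rbar (fun r => exists u t, (K u \/ Keps u) /\ 0 <= t /\
    r = norm (minus (to_manifold P h (S t u)) (Seps t (to_manifold P h u)))).

Definition defect {H : HilbertSpace} (D : H -> Prop) (A P : H -> H) (M eps : R) : R :=
  M / lambda_plus D A P + M / alpha D A P eps.

Definition strongly_monotone {H : HilbertSpace} (A F P : H -> H) (sigma : R) : Prop :=
  forall p1 p2 q, range P p1 -> range P p2 -> range (complement P) q ->
    sigma * (norm (minus p1 p2)) ^ 2 <=
    inner (minus (A (minus p1 p2)) (P (minus (F (plus p1 q)) (F (plus p2 q)))))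
          (minus p1 p2).

(* Main.v *)
(** Write Lam = mu / eps^2, P and Q = 1 - P for the spectral projections, lam for
    the bottom of the spectrum of A on the range of Q, al = lam + 1/eps, and
    R u = P u + h (P u).

    Spectral side: A is bounded by Lam on the range of P.  Since H is
    infinite-dimensional and the resolvent is compact, the range of Q is not zero
    and A has a lowest eigenvalue there, which is lam; it exceeds Lam because its
    eigenvector is orthogonal to the range of P.  Hence gamma >= 1/eps, and
    |Q exp(-tA) w| <= exp(-lam t) |Q w|, so that by Duhamel's formula
    |Q u| <= M/lam is preserved by S(t) and holds on the attractor of S.
    Consequently |R u - u| <= d = M/lam + M/al on that attractor.

    Attractors: a point of the attractor of S is u = S(t) w with w in it; R u is
    within eta of S_eps(t) R w, which is close to the attractor of S_eps for large
    t.  A point of the attractor of S_eps lies on the manifold, is S_eps(t) w with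
    w = R w, and is within eta of R S(t) w, while S(t) w is close to the attractor
    of S.

    Strong monotonicity: z = P S(t) u - P S_eps(t) R u satisfies z(0) = 0 and
    (|z|^2)' <= -2 sigma |z|^2 + 2 L d |z|, whence |z| <= L d / sigma for all t. *)

Require Import Defs.
From Stdlib Require Import Reals Lra Lia Arith List Classical ClassicalEpsilon.
From Coquelicot Require Import Coquelicot.
From Stdlib Require Import ssreflect.
Open Scope R_scope.

(** * Inner products and sequences *)

Section InnerProduct.
Context {H : HilbertSpace}.
Implicit Types u v w : H.

(** No spectral theorem is invoked: [P] is known only as the orthogonal projection onto the closed
    span of the low eigenvectors, and each spectral fact is recovered from that. The bound of A on a
    span cannot be read off coefficients, since the eigenvectors in a combination need not be
    orthogonal or distinct; it comes from the growth of A^N v. Solvability of (A - lam) u = f comes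
    from minimizing the residual, which is orthogonal to the range of A - lam and then vanishes by a
    bound on the quadratic form. The eigenvalue above the cutoff comes from maximizing the form of
    the positive operator (A + 1)^-1 on the range of Q. The semigroup is given only by its generator
    and continuity from the right at 0, so local uniform boundedness and two-sided derivatives on D
    have to be established first; decay is then an energy estimate, extended by density. The gap
    gamma >= 8 L makes R Lipschitz in P u with constant 3/2. In the Hausdorff bound this constant
    multiplies only a distance that tends to 0, so eta and d enter with coefficient 1; it survives
    only in the estimate of eta under strong monotonicity. *)

Lemma inner_plus_r u v w : inner u (plus v w) = inner u v + inner u w.
Proof. now rewrite inner_sym inner_plus_l (inner_sym _ v) (inner_sym _ w). Qed.

Lemma inner_scal_r (a : R) u v : inner u (scal a v) = a * inner u v.
Proof. now rewrite inner_sym inner_scal_l inner_sym. Qed.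

Lemma inner_zero_l v : inner zero v = 0.
Proof.
  pose proof (inner_plus_l _ zero zero v) as E; rewrite plus_zero_l in E; lra.
Qed.

Lemma inner_opp_l u v : inner (opp u) v = - inner u v.
Proof.
  pose proof (inner_plus_l _ (opp u) u v) as E.
  rewrite plus_opp_l inner_zero_l in E; lra.
Qed.

Lemma inner_opp_r u v : inner u (opp v) = - inner u v.
Proof. now rewrite inner_sym inner_opp_l inner_sym. Qed.

Lemma inner_zero_r v : inner v zero = 0.
Proof. now rewrite inner_sym inner_zero_l. Qed.

Lemma inner_minus_l u v w : inner (minus u v) w = inner u w - inner v w.
Proof. unfold minus; rewrite inner_plus_l inner_opp_l; ring. Qed.

Lemma inner_minus_r u v w : inner u (minus v w) = inner u v - inner u w.
Proof. now rewrite inner_sym inner_minus_l (inner_sym _ v) (inner_sym _ w). Qed.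

Lemma norm_sqr u : norm u * norm u = inner u u.
Proof. rewrite norm_inner; apply sqrt_sqrt, inner_ge_0. Qed.

Lemma norm_nonneg u : 0 <= norm u.
Proof. apply norm_ge_0. Qed.

Lemma inner_definite u : inner u u = 0 -> u = zero.
Proof. intro E; apply: norm_eq_zero; now rewrite norm_inner E sqrt_0. Qed.

Lemma inner_ext u v : (forall w, inner u w = inner v w) -> u = v.
Proof.
  intro E.
  assert (Z : minus u v = zero).
  { apply inner_definite; unfold minus at 1.
    rewrite inner_plus_l inner_opp_l E; ring. }
  rewrite -(plus_zero_r u) -(plus_opp_l v) plus_assoc.
  change (plus u (opp v)) with (minus u v).
  now rewrite Z plus_zero_l.
Qed.

Lemma eq_of_minus_zero u v : minus u v = zero -> u = v.
Proof.
  intro Z; apply inner_ext; intro w.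
  assert (E : inner (minus u v) w = 0) by (rewrite Z; apply inner_zero_l).
  unfold minus in E; rewrite inner_plus_l inner_opp_l in E; lra.
Qed.

End InnerProduct.

Ltac inner_expand :=
  repeat rewrite ?inner_minus_l ?inner_minus_r ?inner_plus_l ?inner_plus_r
    ?inner_opp_l ?inner_opp_r ?inner_scal_l ?inner_scal_r ?inner_zero_l ?inner_zero_r.

Ltac inner_expand_in E :=
  repeat rewrite ?inner_minus_l ?inner_minus_r ?inner_plus_l ?inner_plus_r
    ?inner_opp_l ?inner_opp_r ?inner_scal_l ?inner_scal_r ?inner_zero_l ?inner_zero_r in E.

(** Pairing with an arbitrary vector turns an identity between vectors into a ring identity between
    reals. *)
Ltac vec := apply inner_ext; intro; inner_expand; ring.
Ltac vec_field := apply inner_ext; intro; inner_expand; field.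

(* Coquelicot's canonical structures give convertible but syntactically distinct
   forms of the vector operations, which [lra] would treat as distinct atoms. *)
Ltac fold_ops :=
  match goal with h : HilbertSpace |- _ =>
    let M := constr:(CompleteNormedModule.AbelianMonoid R_AbsRing (hilbert_carrier h)) in
    let G := constr:(CompleteNormedModule.AbelianGroup R_AbsRing (hilbert_carrier h)) in
    let S := constr:(CompleteNormedModule.ModuleSpace R_AbsRing (hilbert_carrier h)) in
    let N := constr:(CompleteNormedModule.NormedModule R_AbsRing (hilbert_carrier h)) in
    repeat match goal with
    | |- context [@zero ?X] =>
        assert_fails (constr_eq X M); change (@zero X) with (@zero M)
    | _ : context [@zero ?X] |- _ =>
        assert_fails (constr_eq X M); change (@zero X) with (@zero M) in *
    | |- context [@plus ?X ?x ?y] =>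
        assert_fails (constr_eq X M); change (@plus X x y) with (@plus M x y)
    | _ : context [@plus ?X ?x ?y] |- _ =>
        assert_fails (constr_eq X M); change (@plus X x y) with (@plus M x y) in *
    | |- context [@minus ?X ?x ?y] =>
        assert_fails (constr_eq X G); change (@minus X x y) with (@minus G x y)
    | _ : context [@minus ?X ?x ?y] |- _ =>
        assert_fails (constr_eq X G); change (@minus X x y) with (@minus G x y) in *
    | |- context [@opp ?X ?x] =>
        assert_fails (constr_eq X G); change (@opp X x) with (@opp G x)
    | _ : context [@opp ?X ?x] |- _ =>
        assert_fails (constr_eq X G); change (@opp X x) with (@opp G x) in *
    | |- context [@scal ?K ?X ?x ?y] =>
        assert_fails (constr_eq X S); change (@scal K X x y) with (@scal R_AbsRing S x y)
    | _ : context [@scal ?K ?X ?x ?y] |- _ =>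
        assert_fails (constr_eq X S); change (@scal K X x y) with (@scal R_AbsRing S x y) in *
    | |- context [@norm ?K ?X ?x] =>
        assert_fails (constr_eq X N); change (@norm K X x) with (@norm R_AbsRing N x)
    | _ : context [@norm ?K ?X ?x] |- _ =>
        assert_fails (constr_eq X N); change (@norm K X x) with (@norm R_AbsRing N x) in *
    end
  end.

(** * Norm inequalities and convergent sequences *)

Section Norms.
Context {H : HilbertSpace}.
Implicit Types u v w : H.

Lemma norm_scal_eq (a : R) u : norm (scal a u) = Rabs a * norm u.
Proof.
  rewrite !norm_inner inner_scal_l inner_scal_r.
  rewrite -Rmult_assoc sqrt_mult_alt; [| apply Rle_0_sqr].
  now rewrite sqrt_Rsqr_abs.
Qed.

Lemma norm_plus_le u v : norm (plus u v) <= norm u + norm v.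
Proof. exact (@norm_triangle R_AbsRing H u v). Qed.

Lemma norm_minus_sym u v : norm (minus u v) = norm (minus v u).
Proof. rewrite -norm_opp; f_equal; vec. Qed.

Lemma norm_minus_self u : norm (minus u u) = 0.
Proof. replace (minus u u) with (@zero H) by vec; apply: norm_zero. Qed.

Lemma norm_minus_le u v : norm (minus u v) <= norm u + norm v.
Proof. unfold minus; rewrite -(norm_opp v); apply norm_plus_le. Qed.

Lemma norm_minus_triangle u v w :
  norm (minus u w) <= norm (minus u v) + norm (minus v w).
Proof.
  replace (minus u w) with (plus (minus u v) (minus v w)) by vec.
  apply norm_plus_le.
Qed.

Lemma norm_le_plus_minus u v : norm u <= norm v + norm (minus u v).
Proof.
  replace u with (plus v (minus u v)) at 1 by vec; apply norm_plus_le.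
Qed.

Lemma norm_pos_neq u : u <> zero -> 0 < norm u.
Proof.
  intro N; destruct (norm_nonneg u) as [G | E]; [exact G |].
  exfalso; apply N; apply: norm_eq_zero; now rewrite -E.
Qed.

Lemma cauchy_schwarz u v : inner u v <= norm u * norm v.
Proof.
  destruct (Req_dec (norm v) 0) as [Z | Z].
  - apply (@norm_eq_zero R_AbsRing H) in Z; subst v.
    rewrite inner_zero_r norm_zero; lra.
  - pose proof (norm_nonneg v). pose proof (norm_nonneg u).
    pose proof (norm_sqr u) as Nu; pose proof (norm_sqr v) as Nv.
    (* Expanding this square and dividing by 2 |u| |v| gives the inequality. *)
    pose proof (inner_ge_0 _ (minus (scal (norm v) u) (scal (norm u) v))) as E.
    inner_expand_in E.
    rewrite (inner_sym _ v u) -Nu -Nv in E.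
    destruct (Req_dec (norm u) 0) as [Zu | Zu].
    { apply (@norm_eq_zero R_AbsRing H) in Zu; subst u.
      rewrite inner_zero_l norm_zero; lra. }
    assert (0 < norm u * norm v) by (apply Rmult_lt_0_compat; lra).
    apply Rmult_le_reg_l with (norm u * norm v); [assumption |].
    nra.
Qed.

Lemma cauchy_schwarz_abs u v : Rabs (inner u v) <= norm u * norm v.
Proof.
  apply Rabs_le; split; [| apply cauchy_schwarz].
  pose proof (cauchy_schwarz (opp u) v) as E.
  rewrite inner_opp_l norm_opp in E; lra.
Qed.

Lemma sqr_le_reg x y : 0 <= y -> x * x <= y * y -> x <= y.
Proof. intros; nra. Qed.

Lemma norm_le_sqr u (c : R) : 0 <= c -> inner u u <= c * c -> norm u <= c.
Proof. intros C E; apply sqr_le_reg; [exact C |]; now rewrite norm_sqr. Qed.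

Lemma norm_small_eq u v :
  (forall r, 0 < r -> norm (minus u v) <= r) -> u = v.
Proof.
  intro E; apply eq_of_minus_zero; apply: norm_eq_zero.
  apply Rle_antisym; [| apply norm_ge_0].
  apply le_epsilon; intros r Hr; rewrite Rplus_0_l; auto.
Qed.

Lemma real_eq_of_close (x y : R) :
  (forall r, 0 < r -> Rabs (x - y) <= r) -> x = y.
Proof.
  intro E; apply Rminus_diag_uniq.
  destruct (Req_dec (x - y) 0) as [Z | Z]; [exact Z |].
  pose proof (Rabs_pos_lt _ Z) as G; specialize (E (Rabs (x - y) / 2)); lra.
Qed.

Definition tends (x : nat -> H) (u : H) : Prop :=
  forall r, 0 < r -> exists N, forall n, (N <= n)%nat -> norm (minus (x n) u) <= r.

Definition tends_R (x : nat -> R) (l : R) : Prop :=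
  forall r, 0 < r -> exists N, forall n, (N <= n)%nat -> Rabs (x n - l) <= r.

Lemma complete_seq (x : nat -> H) :
  (forall r, 0 < r -> exists N, forall n m, (N <= n)%nat -> (N <= m)%nat ->
     norm (minus (x n) (x m)) <= r) ->
  exists u, tends x u.
Proof.
  intro C.
  destruct (proj1 (filterlim_locally_cauchy (F := eventually) x)) as [u Hu].
  { intros [e He]; destruct (C (e / 2)) as [N HN]; [simpl; lra |].
    exists (fun n => (N <= n)%nat); split; [now exists N |].
    intros n m Hn Hm; apply (@norm_compat1 R_AbsRing H).
    apply Rle_lt_trans with (1 := HN m n Hm Hn); simpl; lra. }
  exists u; intros r Hr.
  pose proof (proj1 (filterlim_locally_ball_norm x u) Hu (mkposreal r Hr)) as [N HN].
  exists N; intros n Hn; left; apply (HN n Hn).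
Qed.

Lemma tends_unique x u v : tends x u -> tends x v -> u = v.
Proof.
  intros U V; apply norm_small_eq; intros r Hr.
  destruct (U (r / 2)) as [N HN]; [lra |].
  destruct (V (r / 2)) as [K HK]; [lra |].
  specialize (HN (max N K) ltac:(lia)); specialize (HK (max N K) ltac:(lia)).
  pose proof (norm_minus_triangle u (x (max N K)) v) as T.
  rewrite (norm_minus_sym u (x _)) in T; lra.
Qed.

Lemma tends_inner x u v : tends x u -> tends_R (fun n => inner (x n) v) (inner u v).
Proof.
  intros T r Hr.
  pose proof (norm_nonneg v).
  destruct (T (r / (norm v + 1))) as [N HN]; [apply Rdiv_lt_0_compat; lra |].
  exists N; intros n Hn; specialize (HN n Hn).
  replace (inner (x n) v - inner u v) with (inner (minus (x n) u) v)
    by (inner_expand; ring).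
  eapply Rle_trans; [apply cauchy_schwarz_abs |].
  apply Rle_trans with (r / (norm v + 1) * norm v);
    [now apply Rmult_le_compat_r |].
  apply Rmult_le_reg_r with (norm v + 1); [lra |].
  replace (r / (norm v + 1) * norm v * (norm v + 1)) with (r * norm v) by (field; lra).
  nra.
Qed.

Lemma tends_R_unique x l k : tends_R x l -> tends_R x k -> l = k.
Proof.
  intros U V; apply real_eq_of_close; intros r Hr.
  destruct (U (r / 2)) as [N HN]; [lra |].
  destruct (V (r / 2)) as [K HK]; [lra |].
  specialize (HN (max N K) ltac:(lia)); specialize (HK (max N K) ltac:(lia)).
  replace (l - k) with ((x (max N K) - k) - (x (max N K) - l)) by ring.
  eapply Rle_trans; [apply Rabs_triang |]; rewrite Rabs_Ropp; lra.
Qed.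

Lemma tends_R_ext x y l : (forall n, x n = y n) -> tends_R x l -> tends_R y l.
Proof.
  intros E T r Hr; destruct (T r Hr) as [N HN]; exists N; intros n Hn.
  rewrite -E; auto.
Qed.

Lemma tends_norm_le x u (c : R) : (forall n, norm (x n) <= c) -> tends x u -> norm u <= c.
Proof.
  intros B T; apply le_epsilon; intros r Hr; destruct (T r Hr) as [N HN].
  pose proof (norm_le_plus_minus u (x N)); specialize (B N); specialize (HN N (le_n N)).
  rewrite norm_minus_sym in HN; lra.
Qed.

Lemma tends_lip (f : H -> H) (c : R) x u :
  (forall v w, norm (minus (f v) (f w)) <= c * norm (minus v w)) ->
  tends x u -> tends (fun n => f (x n)) (f u).
Proof.
  intros L T r Hr.
  destruct (T (r / (Rabs c + 1))) as [N HN].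
  { pose proof (Rabs_pos c); apply Rdiv_lt_0_compat; lra. }
  exists N; intros n Hn; specialize (HN n Hn).
  pose proof (Rabs_pos c); pose proof (Rle_abs c).
  pose proof (norm_nonneg (minus (x n) u)).
  eapply Rle_trans; [apply L |].
  apply Rle_trans with ((Rabs c + 1) * (r / (Rabs c + 1))); [nra |].
  right; field; lra.
Qed.

Lemma tends_plus x y u v : tends x u -> tends y v ->
  tends (fun n => plus (x n) (y n)) (plus u v).
Proof.
  intros U V r Hr.
  destruct (U (r / 2)) as [N HN]; [lra |].
  destruct (V (r / 2)) as [K HK]; [lra |].
  exists (max N K); intros n Hn.
  specialize (HN n ltac:(lia)); specialize (HK n ltac:(lia)).
  replace (minus (plus (x n) (y n)) (plus u v))
    with (plus (minus (x n) u) (minus (y n) v)) by vec.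
  eapply Rle_trans; [apply norm_plus_le |]; lra.
Qed.

Lemma tends_scal (a : R) x u : tends x u ->
  tends (fun n => scal a (x n)) (scal a u).
Proof.
  intro T; apply (tends_lip (fun w => scal a w) (Rabs a)); [| exact T].
  intros v w; right; rewrite -norm_scal_eq; f_equal; vec.
Qed.

End Norms.

Lemma inv_INR_small (r : R) : 0 < r -> exists N, forall n, (N <= n)%nat -> / (INR n + 1) <= r.
Proof.
  intro Hr; destruct (nfloor_ex (/ r)) as [N HN].
  { left; now apply Rinv_0_lt_compat. }
  exists N; intros n Hn; apply le_INR in Hn.
  rewrite -(Rinv_inv r); apply Rinv_le_contravar; [now apply Rinv_0_lt_compat | lra].
Qed.

(** * Compact sets: boundedness and cluster points *)

Section Compactness.
Context {H : HilbertSpace}.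

Lemma open_ball_norm_R (x : H) (r : R) : open (fun y : H => norm (minus y x) < r).
Proof.
  intros y Hy.
  assert (G : 0 < r - norm (minus y x)) by lra.
  pose proof (locally_ball_norm y (mkposreal _ G)) as B.
  eapply filter_imp; [| exact B].
  intros z Hz.
  refine (Rle_lt_trans _ _ _ (norm_minus_triangle (z : H) y x) _).
  assert (Hz' : norm (minus (z : H) y) < r - norm (minus (y : H) x)) by exact Hz.
  lra.
Qed.

Lemma compact_bounded (K : H -> Prop) : compact_set K ->
  exists r, 0 < r /\ forall u, K u -> norm u <= r.
Proof.
  intro C.
  destruct (C nat (fun n u => norm (minus u zero) < INR n)) as [l Hl].
  - intro n; apply open_ball_norm_R.
  - intros x _; destruct (nfloor_ex (norm x)) as [n Hn]; [apply norm_nonneg |].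
    exists (S n); rewrite S_INR.
    replace (minus x zero) with x by vec; lra.
  - exists (INR (list_max l) + 1); split; [pose proof (pos_INR (list_max l)); lra |].
    intros u Hu; destruct (Hl u Hu) as [n [In Hn]].
    replace (minus u zero) with u in Hn by vec.
    assert (n <= list_max l)%nat.
    { pose proof (proj1 (list_max_le l (list_max l)) (le_n _)) as F.
      rewrite Forall_forall in F; auto. }
    match goal with h : (n <= _)%nat |- _ => apply le_INR in h end; lra.
Qed.

Lemma compact_cluster (K : H -> Prop) (x : nat -> H) :
  compact_set K -> (forall n, K (x n)) ->
  exists u, forall r N, 0 < r -> exists n, (N <= n)%nat /\ norm (minus (x n) u) < r.
Proof.
  intros C Kx; apply NNPP; intro Hno.
  (* An index is a centre, a radius and a rank from which the sequence stays out of that ball.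
     Without a cluster point these balls cover K, and a finite subcover fails to contain the term
     whose rank is the largest one occurring in it. *)
  set (I := {i : H * R * nat | 0 < snd (fst i) /\
    forall n, (snd i <= n)%nat -> snd (fst i) <= norm (minus (x n) (fst (fst i)))}).
  destruct (C I (fun i u => norm (minus u (fst (fst (proj1_sig i)))) < snd (fst (proj1_sig i))))
    as [l Hl].
  - intro i; apply open_ball_norm_R.
  - intros u Hu.
    destruct (not_all_ex_not _ _ (not_ex_all_not _ _ Hno u)) as [r Hr].
    apply not_all_ex_not in Hr; destruct Hr as [N HN].
    apply imply_to_and in HN; destruct HN as [Hr HN].
    assert (Hi : 0 < snd (fst (u, r, N)) /\ forall n, (snd (u, r, N) <= n)%nat ->
       snd (fst (u, r, N)) <= norm (minus (x n) (fst (fst (u, r, N))))).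
    { simpl; split; [exact Hr |]; intros n Hn; apply Rnot_lt_le; intro Hlt.
      apply HN; exists n; auto. }
    exists (exist _ (u, r, N) Hi); simpl.
    now rewrite norm_minus_self.
  - set (N := list_max (map (fun i : I => snd (proj1_sig i)) l)).
    destruct (Hl (x N) (Kx N)) as [i [Ii Hi]].
    destruct (proj2_sig i) as [_ Hfar].
    assert (snd (proj1_sig i) <= N)%nat.
    { pose proof (proj1 (list_max_le _ N) (le_n _)) as F.
      rewrite Forall_forall in F; apply F, in_map_iff; now exists i. }
    specialize (Hfar N ltac:(assumption)); lra.
Qed.

End Compactness.

(** * Low modes and the spectral projection *)

Lemma functional_choice_R {X Y : Type} (R : X -> Y -> Prop) :
  (forall x, exists y, R x y) -> exists f, forall x, R x (f x).
Proof.
  intro E.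
  exists (fun x => proj1_sig (constructive_indefinite_description _ (E x))).
  intro x; apply proj2_sig.
Qed.

Section Span.
Context {H : HilbertSpace}.
Implicit Types (u v e : H) (E : H -> Prop).

(** [sum_n] always has at least one term, so the base case is a multiple of one vector rather than
    zero. *)
Lemma span_ind E (Q : H -> Prop) :
  (forall (a : R) e, E e -> Q (scal a e)) ->
  (forall u (a : R) e, Q u -> E e -> Q (plus u (scal a e))) ->
  forall u, span E u -> Q u.
Proof.
  intros B S u [n [c [e [He ->]]]].
  induction n as [| n IH].
  - rewrite sum_O; apply B, He.
  - rewrite sum_Sn; apply S; [exact IH | apply He].
Qed.

Lemma span_single E (a : R) e : E e -> span E (scal a e).
Proof.
  intro He; exists 0%nat, (fun _ => a), (fun _ => e); split; [auto |].
  now rewrite sum_O.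
Qed.

Lemma span_add E u (a : R) e : span E u -> E e -> span E (plus u (scal a e)).
Proof.
  intros [n [c [f [Hf ->]]]] He.
  exists (S n), (fun k => if Nat.leb k n then c k else a),
    (fun k => if Nat.leb k n then f k else e); split.
  - intro k; destruct (Nat.leb_spec k n); auto.
  - rewrite sum_Sn; f_equal.
    + apply sum_n_ext_loc; intros k Hk; destruct (Nat.leb_spec k n); [reflexivity | lia].
    + destruct (Nat.leb_spec (S n) n); [lia | reflexivity].
Qed.

Lemma span_plus E u v : span E u -> span E v -> span E (plus u v).
Proof.
  intros Hu Hv; revert u Hu.
  refine (span_ind E (fun v => forall u, span E u -> span E (plus u v)) _ _ v Hv).
  - intros a e He u Hu; now apply span_add.
  - intros w a e IH He u Hu.
    replace (plus u (plus w (scal a e))) with (plus (plus u w) (scal a e)) by vec.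
    apply span_add; auto.
Qed.

Lemma span_scal E (b : R) u : span E u -> span E (scal b u).
Proof.
  apply (span_ind E (fun u => span E (scal b u))).
  - intros a e He; replace (scal b (scal a e)) with (scal (b * a) e) by vec.
    now apply span_single.
  - intros w a e IH He.
    replace (scal b (plus w (scal a e))) with (plus (scal b w) (scal (b * a) e)) by vec.
    now apply span_add.
Qed.

Lemma closed_span_incl E u : span E u -> closed_span E u.
Proof.
  intros Hu r Hr; exists u; split; [exact Hu |].
  now rewrite norm_minus_self.
Qed.

Lemma closed_span_seq E u : closed_span E u ->
  exists x, (forall n : nat, span E (x n)) /\ tends x u.
Proof.
  intro C.
  destruct (functional_choice_R (fun (n : nat) v => span E v /\ norm (minus u v) < / (INR n + 1)))
    as [x Hx].
  { intro n; apply C, Rinv_0_lt_compat; pose proof (pos_INR n); lra. }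
  exists x; split; [intro n; apply Hx |].
  intros r Hr; destruct (inv_INR_small r Hr) as [N HN]; exists N; intros n Hn.
  destruct (Hx n) as [_ G]; specialize (HN n Hn).
  rewrite norm_minus_sym; lra.
Qed.

Lemma closed_span_limit E x u :
  (forall n : nat, closed_span E (x n)) -> tends x u -> closed_span E u.
Proof.
  intros C T r Hr; destruct (T (r / 2)) as [N HN]; [lra |].
  destruct (C N (r / 2)) as [v [Hv G]]; [lra |].
  exists v; split; [exact Hv |]; specialize (HN N (le_n N)).
  rewrite norm_minus_sym in HN.
  pose proof (norm_minus_triangle u (x N) v); lra.
Qed.

Lemma closed_span_plus E u v :
  closed_span E u -> closed_span E v -> closed_span E (plus u v).
Proof.
  intros U V r Hr.
  destruct (U (r / 2)) as [x [Hx Gx]]; [lra |].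
  destruct (V (r / 2)) as [y [Hy Gy]]; [lra |].
  exists (plus x y); split; [now apply span_plus |].
  replace (minus (plus u v) (plus x y)) with (plus (minus u x) (minus v y)) by vec.
  pose proof (norm_plus_le (minus u x) (minus v y)); fold_ops; lra.
Qed.

Lemma closed_span_scal E (b : R) u : closed_span E u -> closed_span E (scal b u).
Proof.
  intro U; destruct (closed_span_seq E u U) as [x [Hx T]].
  apply closed_span_limit with (fun n => scal b (x n)).
  - intro n; apply closed_span_incl, span_scal, Hx.
  - now apply tends_scal.
Qed.

Lemma closed_span_minus E u v :
  closed_span E u -> closed_span E v -> closed_span E (minus u v).
Proof.
  intros U V; replace (minus u v) with (plus u (scal (-1) v)) by vec.
  apply closed_span_plus; [exact U | now apply closed_span_scal].
Qed.

End Span.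

(** * Self-adjoint operators: symmetry and closedness *)

Section SelfAdjoint.
Context {H : HilbertSpace} {D : H -> Prop} {A : H -> H}.
Context (Asa : self_adjoint D A).
Implicit Types u v w : H.

Lemma sa_linear : linear_operator D A.
Proof. apply Asa. Qed.

Lemma sa_symmetric u v : D u -> D v -> inner (A u) v = inner u (A v).
Proof.
  intros Hu Hv; destruct Asa as [_ [_ G]].
  now apply (proj1 (G v (A v))).
Qed.

Lemma sa_adjoint u w : (forall v, D v -> inner (A v) u = inner v w) -> D u /\ A u = w.
Proof. intro E; destruct Asa as [_ [_ G]]; now apply G. Qed.

Lemma dom_minus u v : D u -> D v -> D (minus u v).
Proof.
  intros; replace (minus u v) with (plus u (scal (-1) v)) by vec.
  apply (dom_plus _ _ sa_linear); [| apply (dom_scal _ _ sa_linear)]; assumption.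
Qed.

Lemma op_minus u v : D u -> D v -> A (minus u v) = minus (A u) (A v).
Proof.
  intros; replace (minus u v) with (plus u (scal (-1) v)) by vec.
  rewrite (op_plus _ _ sa_linear) ?(op_scal _ _ sa_linear) //; [vec |].
  now apply (dom_scal _ _ sa_linear).
Qed.

Lemma op_zero : A zero = zero.
Proof.
  pose proof (dom_zero _ _ sa_linear) as Z.
  replace (@zero H) with (scal 0 (@zero H)) at 1 by vec.
  rewrite (op_scal _ _ sa_linear) //; vec.
Qed.

(** An adjoint is closed: the identity <A x_n, v> = <x_n, A v> passes to the limit, and
    self-adjointness puts u back into D. *)
Lemma sa_closed x u w : (forall n : nat, D (x n)) -> tends x u ->
  tends (fun n => A (x n)) w -> D u /\ A u = w.
Proof.
  intros Dx Tx Ta; apply sa_adjoint; intros v Hv.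
  rewrite inner_sym (inner_sym _ v).
  apply (tends_R_unique (fun n => inner (x n) (A v))); [now apply tends_inner |].
  apply (tends_R_ext (fun n => inner (A (x n)) v)); [| now apply tends_inner].
  intro n; now apply sa_symmetric.
Qed.

End SelfAdjoint.

Section LowModes.
Context {H : HilbertSpace} {D : H -> Prop} {A : H -> H}.
Context (Asa : self_adjoint D A) (Lam : R) (Lam_pos : 0 < Lam).
Implicit Types u v w e : H.

Local Notation low := (low_eigenvector D A Lam).
Local Notation X := (closed_span low).

Lemma low_zero : low zero.
Proof.
  split; [apply (dom_zero _ _ (sa_linear Asa)) |].
  exists 0; split; [lra |]; rewrite (op_zero Asa); vec.
Qed.

Lemma low_orbit v : span low v ->
  exists V : nat -> H, V 0%nat = v /\
    (forall N, D (V N) /\ A (V N) = V (S N) /\ span low (V N)) /\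
    exists C, forall N, norm (V N) <= C * Lam ^ N.
Proof.
  assert (one : forall (a : R) e, low e -> exists V : nat -> H, V 0%nat = scal a e /\
    (forall N, D (V N) /\ A (V N) = V (S N) /\ exists b : R, V N = scal b e) /\
    exists C, forall N, norm (V N) <= C * Lam ^ N).
  { intros a e [De [lam [Hlam Ae]]].
    exists (fun N => scal (a * lam ^ N) e); split; [| split].
    - simpl; vec.
    - intro N; repeat split.
      + now apply (dom_scal _ _ (sa_linear Asa)).
      + rewrite (op_scal _ _ (sa_linear Asa)) // Ae; simpl; vec.
      + now exists (a * lam ^ N).
    - exists (Rabs a * norm e); intro N.
      rewrite norm_scal_eq Rabs_mult -RPow_abs (Rabs_pos_eq lam); [| lra].
      assert (lam ^ N <= Lam ^ N) by (apply pow_incr; lra).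
      assert (0 <= Rabs a * norm e)
        by (apply Rmult_le_pos; [apply Rabs_pos | apply norm_nonneg]).
      nra. }
  intro Hv; pattern v; refine (span_ind low _ _ _ v Hv); clear v Hv.
  - intros a e He; destruct (one a e He) as [V [V0 [VS VC]]].
    exists V; split; [exact V0 | split; [| exact VC]].
    intro N; destruct (VS N) as [DV [AV [b Eb]]]; repeat split; auto.
    rewrite Eb; now apply span_single.
  - intros u a e [U [U0 [US [C HC]]]] He.
    destruct (one a e He) as [V [V0 [VS [C' HC']]]].
    exists (fun N => plus (U N) (V N)); split; [now rewrite U0 V0 | split].
    + intro N; destruct (VS N) as [DV [AV [b Eb]]]; destruct (US N) as [DU [AU SU]].
      repeat split.
      * now apply (dom_plus _ _ (sa_linear Asa)).
      * now rewrite (op_plus _ _ (sa_linear Asa)) // AU AV.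
      * rewrite Eb; now apply span_add.
    + exists (C + C'); intro N; specialize (HC N); specialize (HC' N).
      pose proof (norm_plus_le (U N) (V N)); lra.
Qed.

(* By symmetry the norms of the vectors A^N v are log-convex in N, so the ratio
   |Av| / |v| is at most their exponential growth rate, which is at most Lam. *)
Lemma low_span_bound v : span low v -> norm (A v) <= Lam * norm v.
Proof.
  intro Hv; destruct (low_orbit v Hv) as [V [<- [VS [C HC]]]].
  destruct (VS 0%nat) as [_ [-> _]].
  apply Rnot_lt_le; intro Hlt.
  set (a := fun N => norm (V N)) in *.
  change (Lam * a 0%nat < a 1%nat) in Hlt.
  assert (a_nonneg : forall N, 0 <= a N) by (intro; apply norm_nonneg).
  assert (logconvex : forall N, a (S N) * a (S N) <= a N * a (S (S N))).
  { intro N; unfold a; rewrite norm_sqr.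
    destruct (VS N) as [DN [AN _]]; destruct (VS (S N)) as [DS [AS _]].
    rewrite -{1}AN (sa_symmetric Asa) // AS; apply cauchy_schwarz. }
  assert (a0 : 0 < a 0%nat).
  { destruct (a_nonneg 0%nat) as [G | E]; [exact G |].
    exfalso; pose proof (logconvex 0%nat) as G; rewrite -E in G Hlt.
    pose proof (a_nonneg 1%nat); nra. }
  set (r := a 1%nat / a 0%nat).
  assert (Hr : Lam < r).
  { apply Rmult_lt_reg_r with (a 0%nat); [exact a0 |].
    unfold r; field_simplify; lra. }
  assert (grow : forall N, r ^ N * a 0%nat <= a N /\ r * a N <= a (S N)).
  { induction N as [| N [I1 I2]].
    - simpl; split; [lra |]; right; unfold r; field; lra.
    - assert (0 < a N).
      { apply Rlt_le_trans with (r ^ N * a 0%nat); [| exact I1].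
        apply Rmult_lt_0_compat; [apply pow_lt; lra | exact a0]. }
      split; [simpl; nra |].
      apply Rmult_le_reg_l with (a N); [assumption |].
      eapply Rle_trans; [| apply logconvex].
      pose proof (a_nonneg (S N)); nra. }
  (* As r > Lam, the powers of r / Lam eventually exceed C / a 0 + 1, whereas the bound C Lam^N caps
     them at C / a 0. *)
  destruct (Pow_x_infinity (r / Lam)) with (b := C / a 0%nat + 1) as [N HN].
  { rewrite Rabs_pos_eq; [| apply Rlt_le, Rdiv_lt_0_compat; lra].
    apply Rmult_lt_reg_r with Lam; [exact Lam_pos |].
    replace (r / Lam * Lam) with r by (field; lra); lra. }
  specialize (HN N (le_n N)).
  assert (0 < (r / Lam) ^ N) by (apply pow_lt, Rdiv_lt_0_compat; lra).
  assert (0 < Lam ^ N) by now apply pow_lt.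
  rewrite Rabs_pos_eq in HN; [| lra].
  destruct (grow N) as [G _]; specialize (HC N); fold (a N) in HC.
  assert (E : (r / Lam) ^ N * Lam ^ N = r ^ N).
  { rewrite -Rpow_mult_distr; f_equal; field; lra. }
  assert ((r / Lam) ^ N * a 0%nat <= C).
  { apply Rmult_le_reg_r with (Lam ^ N); [assumption |]; rewrite -E in G; nra. }
  assert ((C / a 0%nat + 1) * a 0%nat <= C).
  { eapply Rle_trans; [| eassumption]; apply Rmult_le_compat_r; lra. }
  assert ((C / a 0%nat + 1) * a 0%nat = C + a 0%nat) by (field; lra).
  lra.
Qed.

(** The bound on the span makes the images of an approximating sequence Cauchy; closedness of A then
    places the limit in D and carries the bound over. *)
Lemma low_closure u : X u -> D u /\ norm (A u) <= Lam * norm u /\ X (A u).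
Proof.
  intro Xu; destruct (closed_span_seq _ _ Xu) as [x [Sx Tx]].
  assert (Dx : forall n, D (x n)).
  { intro n; destruct (low_orbit _ (Sx n)) as [V [E [VS _]]]; rewrite -E; apply VS. }
  assert (SA : forall n, span low (A (x n))).
  { intro n; destruct (low_orbit _ (Sx n)) as [V [E [VS _]]].
    rewrite -E (proj1 (proj2 (VS 0%nat))); apply VS. }
  destruct (complete_seq (fun n => A (x n))) as [w Tw].
  { intros r Hr; destruct (Tx (r / Lam / 2)) as [N HN].
    { apply Rdiv_lt_0_compat; [apply Rdiv_lt_0_compat |]; lra. }
    exists N; intros n m Hn Hm.
    rewrite -(op_minus Asa) //.
    eapply Rle_trans.
    { apply low_span_bound.
      replace (minus (x n) (x m)) with (plus (x n) (scal (-1) (x m))) by vec.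
      apply span_plus; [apply Sx | apply span_scal, Sx]. }
    pose proof (HN n Hn) as G1; pose proof (HN m Hm) as G2.
    rewrite norm_minus_sym in G2.
    pose proof (norm_minus_triangle (x n) u (x m)) as T.
    apply Rle_trans with (Lam * (r / Lam)); [| right; field; lra].
    apply Rmult_le_compat_l; lra. }
  destruct (sa_closed Asa x u w Dx Tx Tw) as [Du Au].
  split; [exact Du |]; rewrite Au; split.
  - apply le_epsilon; intros r Hr.
    destruct (Tw (r / 2)) as [N HN]; [lra |].
    destruct (Tx (r / 2 / Lam)) as [K HK]; [apply Rdiv_lt_0_compat; lra |].
    set (n := max N K); specialize (HN n ltac:(lia)); specialize (HK n ltac:(lia)).
    pose proof (norm_le_plus_minus w (A (x n))) as T1.
    pose proof (norm_le_plus_minus (x n) u) as T2.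
    pose proof (low_span_bound _ (Sx n)).
    rewrite norm_minus_sym in HN.
    assert (Lam * norm (x n) <= Lam * (norm u + r / 2 / Lam))
      by (apply Rmult_le_compat_l; lra).
    assert (Lam * (norm u + r / 2 / Lam) = Lam * norm u + r / 2) by (field; lra).
    lra.
  - apply closed_span_limit with (2 := Tw); intro n; apply closed_span_incl, SA.
Qed.

(** * The orthogonal projection onto the low modes and its commutation with A *)

Context {P : H -> H} (P_spec : is_spectral_projection D A Lam P).

Local Notation Q := (complement P).

Lemma proj_in u : X (P u).
Proof. apply P_spec. Qed.

Lemma proj_orth u v : X v -> inner (minus u (P u)) v = 0.
Proof. apply P_spec. Qed.

(** [is_spectral_projection] does not postulate linearity. Linearity, idempotence and commutation
    with A are all obtained by checking this characterization of P u. *)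
Lemma proj_unique u x : X x -> (forall v, X v -> inner (minus u x) v = 0) -> P u = x.
Proof.
  intros Xx O; apply eq_of_minus_zero, inner_definite.
  pose proof (closed_span_minus _ _ _ (proj_in u) Xx) as Xd.
  pose proof (O _ Xd) as E1; pose proof (proj_orth u _ Xd) as E2.
  inner_expand_in E1; inner_expand_in E2; inner_expand; lra.
Qed.

Lemma proj_plus u v : P (plus u v) = plus (P u) (P v).
Proof.
  apply proj_unique; [apply closed_span_plus; apply proj_in |].
  intros w Xw; pose proof (proj_orth u w Xw) as E1; pose proof (proj_orth v w Xw) as E2.
  inner_expand_in E1; inner_expand_in E2; inner_expand; lra.
Qed.

Lemma proj_scal (a : R) u : P (scal a u) = scal a (P u).
Proof.
  apply proj_unique; [apply closed_span_scal, proj_in |].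
  intros w Xw; pose proof (proj_orth u w Xw) as E1.
  inner_expand_in E1; inner_expand; nra.
Qed.

Lemma proj_minus u v : P (minus u v) = minus (P u) (P v).
Proof.
  replace (minus u v) with (plus u (scal (-1) v)) by vec.
  rewrite proj_plus proj_scal; vec.
Qed.

Lemma proj_id x : X x -> P x = x.
Proof.
  intro Xx; apply proj_unique; [exact Xx |]; intros v _; inner_expand; ring.
Qed.

Lemma proj_zero u : (forall v, X v -> inner u v = 0) -> P u = zero.
Proof.
  intro O; apply proj_unique; [apply closed_span_incl |].
  - replace (@zero H) with (scal 0 (@zero H)) by vec; apply span_single, low_zero.
  - intros v Xv; inner_expand; rewrite (O v Xv); ring.
Qed.

Lemma range_proj u : range P u <-> X u.
Proof.
  split; [intros [v ->]; apply proj_in |].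
  intro Xu; exists u; now rewrite proj_id.
Qed.

Lemma range_compl u : range Q u <-> P u = zero.
Proof.
  split.
  - intros [v ->]; unfold complement; rewrite proj_minus (proj_id (P v)); [| apply proj_in].
    vec.
  - intro Z; exists u; unfold complement; rewrite Z; vec.
Qed.

Lemma compl_range u : range Q (Q u).
Proof. now exists u. Qed.

Lemma compl_id u : range Q u -> Q u = u.
Proof. intro R; apply range_compl in R; unfold complement; rewrite R; vec. Qed.

Lemma compl_minus u v : Q (minus u v) = minus (Q u) (Q v).
Proof. unfold complement; rewrite proj_minus; vec. Qed.

Lemma compl_orth u v : range Q u -> X v -> inner u v = 0.
Proof. intros [w ->] Xv; now apply proj_orth. Qed.

Lemma proj_compl_sqr u : inner u u = inner (P u) (P u) + inner (Q u) (Q u).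
Proof.
  pose proof (proj_orth u (P u) (proj_in u)) as E.
  unfold complement; inner_expand_in E; inner_expand.
  rewrite (inner_sym _ (P u) u) in E |- *; lra.
Qed.

Lemma proj_norm u : norm (P u) <= norm u.
Proof.
  apply norm_le_sqr; [apply norm_nonneg |].
  rewrite norm_sqr (proj_compl_sqr u); pose proof (inner_ge_0 _ (Q u)); lra.
Qed.

Lemma compl_norm u : norm (Q u) <= norm u.
Proof.
  apply norm_le_sqr; [apply norm_nonneg |].
  rewrite norm_sqr (proj_compl_sqr u); pose proof (inner_ge_0 _ (P u)); lra.
Qed.

Lemma proj_symmetric u v : inner (P u) v = inner u (P v).
Proof.
  pose proof (proj_orth u (P v) (proj_in v)) as E1.
  pose proof (proj_orth v (P u) (proj_in u)) as E2.
  inner_expand_in E1; inner_expand_in E2.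
  rewrite (inner_sym _ v (P u)) in E2; rewrite (inner_sym _ (P v) (P u)) in E2; lra.
Qed.

Lemma proj_dom u : D (P u).
Proof. apply low_closure, proj_in. Qed.

Lemma compl_dom u : D u -> D (Q u).
Proof. intro Du; apply (dom_minus Asa); [exact Du | apply proj_dom]. Qed.

(** X is invariant under A, so symmetry moves A from Q u onto the test vector and keeps A (Q u)
    orthogonal to X. *)
Lemma proj_op u : D u -> P (A u) = A (P u).
Proof.
  intro Du; apply proj_unique; [apply low_closure, proj_in |].
  intros v Xv; destruct (low_closure v Xv) as [Dv [_ XA]].
  rewrite -(op_minus Asa) //; [| apply proj_dom].
  rewrite (sa_symmetric Asa) //; [now apply proj_orth |].
  now apply compl_dom.
Qed.

Lemma compl_op u : D u -> Q (A u) = A (Q u).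
Proof.
  intro Du; unfold complement; rewrite proj_op // (op_minus Asa) //; apply proj_dom.
Qed.

End LowModes.

(** * Resolvents by least squares *)

Lemma real_sup (E : R -> Prop) : (exists x, E x) -> (exists m, forall x, E x -> x <= m) ->
  exists s, (forall x, E x -> x <= s) /\ forall r, 0 < r -> exists x, E x /\ s - r < x.
Proof.
  intros [x0 Ex] [m Hm].
  destruct (completeness E) as [s [U L]]; [now exists m | now exists x0 |].
  exists s; split; [exact U |].
  intros r Hr; apply NNPP; intro N.
  assert (s <= s - r); [| lra].
  apply L; intros x Hx; apply Rnot_lt_le; intro G; apply N; now exists x.
Qed.

Lemma real_inf (E : R -> Prop) : (exists x, E x) -> (exists m, forall x, E x -> m <= x) ->
  exists g, (forall x, E x -> g <= x) /\ forall r, 0 < r -> exists x, E x /\ x < g + r.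
Proof.
  intros [x0 Ex] [m Hm].
  destruct (real_sup (fun y => E (- y))) as [s [U L]].
  - exists (- x0); now rewrite Ropp_involutive.
  - exists (- m); intros x Hx; specialize (Hm _ Hx); lra.
  - exists (- s); split.
    + intros x Hx; assert (- x <= s); [| lra].
      apply U; now rewrite Ropp_involutive.
    + intros r Hr; destruct (L r Hr) as [x [Hx G]]; exists (- x); split; [exact Hx | lra].
Qed.

Section LeastSquares.
Context {H : HilbertSpace}.

(* By the parallelogram identity a minimizing sequence of |B u - f| has Cauchy
   images, hence is itself Cauchy by coercivity. *)
Lemma least_squares (V : H -> Prop) (B : H -> H) (c : R) (f : H) :
  V zero -> (forall u v, V u -> V v -> V (plus u v)) ->
  (forall (a : R) u, V u -> V (scal a u)) ->
  (forall u v, V u -> V v -> B (plus u v) = plus (B u) (B v)) ->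
  (forall (a : R) u, V u -> B (scal a u) = scal a (B u)) ->
  0 < c -> (forall u, V u -> c * norm u <= norm (B u)) ->
  (forall x u w, (forall n : nat, V (x n)) -> tends x u -> tends (fun n => B (x n)) w ->
     V u /\ B u = w) ->
  exists u, V u /\ forall v, V v -> inner (minus (B u) f) (B v) = 0.
Proof.
  intros V0 Vplus Vscal Bplus Bscal cpos coer closed.
  destruct (real_inf (fun s => exists u, V u /\ s = inner (minus (B u) f) (minus (B u) f)))
    as [g [Hg Ag]].
  { exists (inner (minus (B zero) f) (minus (B zero) f)); now exists zero. }
  { exists 0; intros s [u [_ ->]]; apply inner_ge_0. }
  destruct (functional_choice_R (fun (n : nat) u => V u /\
      inner (minus (B u) f) (minus (B u) f) < g + / (INR n + 1))) as [x Hx].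
  { intro n; destruct (Ag (/ (INR n + 1))) as [s [[u [Vu ->]] G]].
    - apply Rinv_0_lt_compat; pose proof (pos_INR n); lra.
    - now exists u. }
  set (r := fun n => minus (B (x n)) f).
  assert (Hr : forall n, inner (r n) (r n) < g + / (INR n + 1)) by (intro n; apply Hx).
  assert (Vx : forall n, V (x n)) by (intro n; apply Hx).
  assert (Er : forall n, r n = minus (B (x n)) f) by reflexivity.
  clearbody r.
  assert (diff : forall n m, inner (minus (r n) (r m)) (minus (r n) (r m)) <=
      2 * (/ (INR n + 1) + / (INR m + 1))).
  { intros n m; pose proof (Hr n) as G1; pose proof (Hr m) as G2.
    assert (G : g <= inner (scal (/ 2) (plus (r n) (r m))) (scal (/ 2) (plus (r n) (r m)))).
    { apply Hg; exists (scal (/ 2) (plus (x n) (x m))); split; [auto |].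
      rewrite Bscal; auto; rewrite Bplus; auto.
      assert (E : scal (/ 2) (plus (r n) (r m))
        = minus (scal (/ 2) (plus (B (x n)) (B (x m)))) f) by (rewrite !Er; vec_field).
      now rewrite E. }
    inner_expand_in G; inner_expand.
    rewrite (inner_sym _ (r m) (r n)) in G |- *; lra. }
  assert (cau : forall e, 0 < e -> exists N, forall n m, (N <= n)%nat -> (N <= m)%nat ->
      norm (minus (B (x n)) (B (x m))) <= e).
  { intros e He; destruct (inv_INR_small (e * e / 4)) as [N HN]; [nra |].
    exists N; intros n m Hn Hm; specialize (diff n m).
    pose proof (HN n Hn); pose proof (HN m Hm).
    apply norm_le_sqr; [lra |].
    replace (minus (B (x n)) (B (x m))) with (minus (r n) (r m)) by (rewrite !Er; vec).
    lra. }
  destruct (complete_seq (fun n => B (x n)) cau) as [w Tw].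
  destruct (complete_seq x) as [u Tu].
  { intros e He; destruct (cau (c * e)) as [N HN]; [nra |].
    exists N; intros n m Hn Hm; specialize (HN n m Hn Hm).
    apply Rmult_le_reg_l with c; [exact cpos |].
    replace (minus (x n) (x m)) with (plus (x n) (scal (-1) (x m))) by vec.
    eapply Rle_trans; [apply coer; auto |].
    rewrite Bplus; auto; rewrite Bscal; auto.
    replace (plus (B (x n)) (scal (-1) (B (x m)))) with (minus (B (x n)) (B (x m))) by vec.
    exact HN. }
  destruct (closed x u w Vx Tu Tw) as [Vu Bu].
  exists u; split; [exact Vu |]; intros v Vv; rewrite Bu.
  set (q := inner (B v) (B v)).
  assert (q0 : 0 <= q) by apply inner_ge_0.
  apply (tends_R_unique (fun n => inner (r n) (B v))).
  - apply (tends_inner r).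
    intros e He; destruct (Tw e He) as [N HN]; exists N; intros n Hn; rewrite Er.
    replace (minus (minus (B (x n)) f) (minus w f)) with (minus (B (x n)) w) by vec; auto.
  - intros e He; destruct (inv_INR_small (e * e / (q + 1))) as [N HN].
    { apply Rdiv_lt_0_compat; nra. }
    exists N; intros n Hn; specialize (HN n Hn); rewrite Rminus_0_r.
    set (b := inner (r n) (B v)).
    (* The optimal step along v would be - b / q; the denominator q + 1 avoids a division by zero
       when B v = 0. Near-minimality within e^2 / (q + 1) then yields t^2 (q + 2) <= e^2 / (q + 1),
       hence b^2 <= e^2. *)
    set (t := - b / (q + 1)).
    assert (G : g <= inner (plus (r n) (scal t (B v))) (plus (r n) (scal t (B v)))).
    { apply Hg; exists (plus (x n) (scal t v)); split; [auto |].
      rewrite Bplus; auto; rewrite Bscal; auto.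
      assert (E : plus (r n) (scal t (B v)) = minus (plus (B (x n)) (scal t (B v))) f)
        by (rewrite !Er; vec).
      now rewrite E. }
    inner_expand_in G; rewrite (inner_sym _ (B v) (r n)) in G; fold b q in G.
    specialize (Hr n).
    assert (Eb : b = - t * (q + 1)) by (unfold t; field; lra).
    assert (G' : 0 <= e * e / (q + 1) + 2 * (t * b) + t * t * q) by lra.
    assert (Q : t * t * (q + 2) <= e * e / (q + 1)) by (rewrite Eb in G'; nra).
    assert (Q2 : b * b <= e * e).
    { rewrite Eb; apply Rmult_le_reg_r with (/ (q + 1)); [apply Rinv_0_lt_compat; lra |].
      change (e * e * / (q + 1)) with (e * e / (q + 1)).
      replace (- t * (q + 1) * (- t * (q + 1)) * / (q + 1)) with (t * t * (q + 1))
        by (field; lra).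
      pose proof (Rle_0_sqr t); unfold Rsqr in *; nra. }
    apply Rabs_le; split; nra.
Qed.

End LeastSquares.

(** * Solvability of shifted equations and the resolvent sets of the two parts of A *)

Section Solve.
Context {H : HilbertSpace} {D : H -> Prop} {A : H -> H}.
Context (Asa : self_adjoint D A).

(** Closedness of A provides the closedness needed for least squares. The residual is only made
    orthogonal to the range of A - lam on Y and D; each use shows it to be zero by a bound on the
    quadratic form of A. *)
Lemma shifted_least_squares (Y : H -> Prop) (lam c : R) (f : H) :
  Y zero -> (forall u v, Y u -> Y v -> Y (plus u v)) ->
  (forall (a : R) u, Y u -> Y (scal a u)) ->
  (forall x u, (forall n : nat, Y (x n)) -> tends x u -> Y u) ->
  0 < c -> (forall u, Y u -> D u -> c * norm u <= norm (minus (A u) (scal lam u))) ->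
  exists u, (Y u /\ D u) /\ forall v, Y v -> D v ->
    inner (minus (minus (A u) (scal lam u)) f) (minus (A v) (scal lam v)) = 0.
Proof.
  intros Y0 Yp Ys Yc cpos coer; pose proof (sa_linear Asa) as LA.
  destruct (least_squares (fun u => Y u /\ D u) (fun u => minus (A u) (scal lam u)) c f)
    as [u [Hu E]].
  - split; [exact Y0 | apply (dom_zero _ _ LA)].
  - intros u v [] []; split; [auto | now apply (dom_plus _ _ LA)].
  - intros a u []; split; [auto | now apply (dom_scal _ _ LA)].
  - intros u v [] []; rewrite (op_plus _ _ LA) //; vec.
  - intros a u []; rewrite (op_scal _ _ LA) //; vec.
  - exact cpos.
  - intros u []; auto.
  - intros x u w Hx Tx Tw.
    destruct (sa_closed Asa x u (plus w (scal lam u))) as [Du Au].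
    + intro n; apply Hx.
    + exact Tx.
    + pose proof (tends_plus _ _ _ _ Tw (tends_scal lam _ _ Tx)) as T.
      intros e He; destruct (T e He) as [N HN]; exists N; intros n Hn.
      replace (A (x n)) with (plus (minus (A (x n)) (scal lam (x n))) (scal lam (x n))) by vec.
      auto.
    + split; [split; [| exact Du] |].
      * apply Yc with x; [intro n; apply Hx | exact Tx].
      * rewrite Au; vec.
  - exists u; split; [exact Hu |]; intros v Yv Dv; apply E; auto.
Qed.

Lemma coercive_resolvent (Y : H -> Prop) (lam c : R) :
  (forall u v, Y u -> Y v -> Y (minus u v)) ->
  0 < c -> (forall u, Y u -> D u -> c * norm u <= norm (minus (A u) (scal lam u))) ->
  (forall f, Y f -> exists u, Y u /\ D u /\ minus (A u) (scal lam u) = f) ->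
  resolvent_set Y D A lam.
Proof.
  intros Ym cpos coer solve; split.
  - intros f Yf; destruct (solve f Yf) as [u [Yu [Du E]]]; exists u; split; [auto |].
    intros v [Yv [Dv E']].
    apply eq_of_minus_zero; apply: norm_eq_zero.
    pose proof (norm_nonneg (minus u v)).
    assert (G : c * norm (minus u v) <= 0); [| fold_ops; nra].
    eapply Rle_trans; [apply coer; [now apply Ym | now apply (dom_minus Asa)] |].
    rewrite (op_minus Asa) //.
    replace (minus (minus (A u) (A v)) (scal lam (minus u v))) with
      (minus (minus (A u) (scal lam u)) (minus (A v) (scal lam v))) by vec.
    rewrite E E'; rewrite norm_minus_self; lra.
  - exists (/ c); intros u Yu Du.
    apply Rmult_le_reg_l with c; [exact cpos |].
    rewrite -Rmult_assoc Rinv_r; [rewrite Rmult_1_l; auto | lra].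
Qed.

Context (Ann : nonnegative D A).

Lemma one_plus_coercive u : D u -> norm u <= norm (plus (A u) u).
Proof.
  intro Du; pose proof (Ann u Du); pose proof (norm_sqr u) as N.
  pose proof (cauchy_schwarz (plus (A u) u) u) as CS; inner_expand_in CS.
  pose proof (norm_nonneg u); pose proof (norm_nonneg (plus (A u) u)).
  destruct (Req_dec (norm u) 0); [fold_ops; lra |].
  apply Rmult_le_reg_r with (norm u); [lra |]; fold_ops; lra.
Qed.

(** A residual g orthogonal to the range of A + 1 lies in the domain of the adjoint with A g = - g,
    which nonnegativity allows only for g = 0. The resolvent in [compact_resolvent] sits at an
    unspecified point, whereas (A + 1)^-1 is positive and symmetric, as a variational argument
    requires. *)
Lemma one_plus_solve f : exists u, D u /\ plus (A u) u = f.
Proof.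
  assert (S : forall u, minus (A u) (scal (-1) u) = plus (A u) u) by (intro; vec).
  destruct (shifted_least_squares (fun _ => True) (-1) 1 f) as [u [[_ Du] E]]; auto.
  { lra. }
  { intros u _ Du; rewrite S Rmult_1_l; now apply one_plus_coercive. }
  exists u; split; [exact Du |].
  rewrite S in E; apply eq_of_minus_zero.
  set (g := minus (plus (A u) u) f) in *; clearbody g.
  destruct (sa_adjoint Asa g (scal (-1) g)) as [Dg Ag].
  { intros v Dv; specialize (E v I Dv); rewrite inner_sym in E.
    inner_expand_in E; inner_expand; lra. }
  pose proof (Ann g Dg) as N; rewrite Ag in N; inner_expand_in N.
  apply inner_definite; pose proof (inner_ge_0 _ g); lra.
Qed.

Context (Lam : R) (Lam_pos : 0 < Lam).
Context {P : H -> H} (P_spec : is_spectral_projection D A Lam P).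
Local Notation X := (closed_span (low_eigenvector D A Lam)).
Local Notation Q := (complement P).

Lemma low_form u : X u -> inner (A u) u <= Lam * inner u u.
Proof.
  intro Xu; destruct (low_closure Asa Lam Lam_pos u Xu) as [Du [B _]].
  eapply Rle_trans; [apply cauchy_schwarz |].
  rewrite -norm_sqr; pose proof (norm_nonneg u); nra.
Qed.

Lemma low_coercive lam u : X u ->
  (lam - Lam) * norm u <= norm (minus (A u) (scal lam u)).
Proof.
  intro Xu; destruct (low_closure Asa Lam Lam_pos u Xu) as [Du [B _]].
  pose proof (low_form u Xu) as G.
  pose proof (cauchy_schwarz (opp (minus (A u) (scal lam u))) u) as CS.
  rewrite norm_opp in CS; inner_expand_in CS.
  rewrite -norm_sqr in CS G.
  destruct (Req_dec (norm u) 0) as [Z | Z].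
  { rewrite Z Rmult_0_r; apply norm_nonneg. }
  pose proof (norm_nonneg u).
  apply Rmult_le_reg_r with (norm u); [lra |].
  fold_ops; lra.
Qed.

Lemma low_resolvent lam : Lam < lam -> resolvent_set (range P) D A lam.
Proof.
  intro Hlam.
  pose proof (range_proj (D := D) (A := A) Lam P_spec) as RP.
  apply coercive_resolvent with (lam - Lam).
  - intros u v Ru Rv; apply RP; apply closed_span_minus; now apply RP.
  - lra.
  - intros u Ru _; apply low_coercive; now apply RP.
  - intros f Rf.
    destruct (shifted_least_squares X lam (lam - Lam) f) as [u [[Xu Du] E]].
    + apply closed_span_incl.
      replace (@zero H) with (scal 0 (@zero H)) by vec.
      apply span_single, (low_zero Asa Lam Lam_pos).
    + apply closed_span_plus.
    + intros a u; apply closed_span_scal.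
    + intros x u; apply closed_span_limit.
    + lra.
    + intros u Xu _; now apply low_coercive.
    + exists u; split; [now apply RP | split; [exact Du |]].
      apply eq_of_minus_zero.
      set (g := minus (minus (A u) (scal lam u)) f) in *.
      assert (Xg : X g).
      { apply closed_span_minus; [| now apply RP].
        apply closed_span_minus;
          [apply (low_closure Asa Lam Lam_pos u Xu) | now apply closed_span_scal]. }
      clearbody g; destruct (low_closure Asa Lam Lam_pos g Xg) as [Dg _].
      (* X is contained in D and invariant, so the residual is itself an admissible test vector: <(A
         - lam) g, g> = 0 contradicts lam > Lam unless g = 0. *)
      specialize (E g Xg Dg); rewrite inner_sym in E; inner_expand_in E.
      pose proof (low_form g Xg); pose proof (inner_ge_0 _ g) as G.
      apply inner_definite; nra.
Qed.

Lemma beta_le : beta D A P <= Lam.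
Proof.
  unfold beta.
  pose proof (Lub_Rbar_correct (spectrum (range P) D A)) as [U L].
  assert (G : Rbar_le (Lub_Rbar (spectrum (range P) D A)) Lam).
  { apply L; intros lam S; simpl; apply Rnot_lt_le; intro Hlt; apply S.
    now apply low_resolvent. }
  (* An infinite supremum has [real] value 0, still below Lam; m_infty occurs when the range of P is
     zero. *)
  destruct (Lub_Rbar (spectrum (range P) D A)); simpl in *; [exact G | lra | lra].
Qed.

Lemma high_resolvent (m lam : R) :
  (forall u, range Q u -> D u -> m * inner u u <= inner (A u) u) ->
  lam < m -> resolvent_set (range Q) D A lam.
Proof.
  intros form Hlam.
  pose proof (range_compl (D := D) (A := A) Lam P_spec) as RQ.
  assert (coer : forall u, range Q u -> D u ->
      (m - lam) * norm u <= norm (minus (A u) (scal lam u))).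
  { intros u Ru Du; pose proof (form u Ru Du) as G.
    pose proof (cauchy_schwarz (minus (A u) (scal lam u)) u) as CS; inner_expand_in CS.
    rewrite -norm_sqr in CS G.
    destruct (Req_dec (norm u) 0) as [Z | Z].
    { rewrite Z Rmult_0_r; apply norm_nonneg. }
    pose proof (norm_nonneg u).
    apply Rmult_le_reg_r with (norm u); [lra |].
    fold_ops; lra. }
  assert (Ym : forall u v, range Q u -> range Q v -> range Q (minus u v)).
  { intros u v Ru Rv; exists (minus u v); rewrite (compl_minus Lam P_spec).
    now rewrite !(compl_id Lam P_spec). }
  assert (Ys : forall (a : R) u, range Q u -> range Q (scal a u)).
  { intros a u Ru; apply RQ in Ru; apply RQ.
    rewrite (proj_scal Lam P_spec) Ru; vec. }
  apply coercive_resolvent with (m - lam); auto; [lra |].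
  intros f Rf.
  destruct (shifted_least_squares (range Q) lam (m - lam) f) as [u [[Xu Du] E]].
  - apply RQ, (proj_zero Asa Lam Lam_pos P_spec); intros; apply inner_zero_l.
  - intros u v Ru Rv; apply RQ; apply RQ in Ru; apply RQ in Rv.
    rewrite (proj_plus Lam P_spec) Ru Rv; vec.
  - exact Ys.
  - intros x u Rx Tx; apply RQ.
    apply (tends_unique (fun n => P (x n))).
    + apply (tends_lip P 1); [| exact Tx].
      intros v w; rewrite -(proj_minus Lam P_spec) Rmult_1_l; apply (proj_norm Lam P_spec).
    + intros e He; exists 0%nat; intros n _; rewrite (proj1 (RQ _) (Rx n)).
      rewrite norm_minus_self; lra.
  - lra.
  - exact coer.
  - exists u; split; [exact Xu | split; [exact Du |]].
    apply eq_of_minus_zero.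
    set (g := minus (minus (A u) (scal lam u)) f) in *.
    assert (Rg : range Q g).
    { apply Ym; [| exact Rf]; apply Ym; [| now apply Ys].
      exists (A u); rewrite (compl_op Asa Lam Lam_pos P_spec) //.
      now rewrite (compl_id Lam P_spec). }
    (* The orthogonality is known only for test vectors in the range of Q. It extends to all of D
       because A (P v) lies in X and g is orthogonal to X; then g is an eigenvector for lam < m,
       hence zero. *)
    clearbody g; destruct (sa_adjoint Asa g (scal lam g)) as [Dg Ag].
    { intros v Dv.
      pose proof (E (Q v) (compl_range v) (compl_dom Asa Lam Lam_pos P_spec v Dv)) as E1.
      pose proof (compl_orth Lam P_spec g (P v) Rg (proj_in Lam P_spec v)) as E2.
      assert (E3 : inner g (A (P v)) = 0).
      { apply (compl_orth Lam P_spec); [exact Rg |].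
        apply (low_closure Asa Lam Lam_pos), (proj_in Lam P_spec). }
      unfold complement in E1; rewrite (op_minus Asa) // in E1;
        [| apply (proj_dom Asa Lam Lam_pos P_spec)].
      rewrite inner_sym (inner_sym _ v).
      inner_expand_in E1; inner_expand; rewrite E2 E3 in E1; lra. }
    pose proof (form g Rg Dg) as G; rewrite Ag in G; inner_expand_in G.
    apply inner_definite; pose proof (inner_ge_0 _ g); nra.
Qed.

End Solve.

(** * The lowest eigenvalue above the cutoff *)

Section GramSchmidt.
Context {H : HilbertSpace}.
Implicit Types (u v e : H) (l : list H).

Fixpoint orthonormal l : Prop :=
  match l with
  | nil => True
  | e :: l => inner e e = 1 /\ (forall f, In f l -> inner e f = 0) /\ orthonormal l
  end.

Fixpoint gram_schmidt l u : H :=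
  match l with
  | nil => u
  | e :: l => minus (gram_schmidt l u) (scal (inner (gram_schmidt l u) e) e)
  end.

Lemma gram_schmidt_orth l u e : orthonormal l -> In e l -> inner (gram_schmidt l u) e = 0.
Proof.
  induction l as [| f l IH]; simpl; [tauto |].
  intros [F1 [F2 F3]] [<- | I]; inner_expand.
  - rewrite F1; ring.
  - rewrite IH // F2 //; ring.
Qed.

Lemma sum_n_first (a : nat -> H) n :
  sum_n a (S n) = plus (a 0%nat) (sum_n (fun k => a (S k)) n).
Proof.
  induction n as [| n IH]; [now rewrite sum_Sn !sum_O |].
  rewrite sum_Sn IH (sum_Sn (fun k => a (S k))); apply eq_sym, plus_assoc.
Qed.

(** [sum_n] includes its upper index, so the sum runs one position past the list; there [nth]
    returns the default zero. *)
Lemma gram_schmidt_span l u : exists c : nat -> R,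
  u = plus (gram_schmidt l u)
        (sum_n (fun k => scal (c k) (nth k l (@zero H))) (length l)).
Proof.
  induction l as [| e l [c E]].
  - exists (fun _ => 0); simpl; rewrite sum_O; vec.
  - exists (fun k => match k with O => inner (gram_schmidt l u) e | S k => c k end).
    simpl length; rewrite sum_n_first; simpl; rewrite {1}E; vec.
Qed.

(** If every vector had zero remainder against some finite list, that list would span H. So each
    list has a normalized continuation, and [L n] collects the first n vectors. *)
Lemma orthonormal_sequence : infinite_dimensional H ->
  exists e : nat -> H, (forall n, inner (e n) (e n) = 1) /\
    forall m n, (m < n)%nat -> inner (e n) (e m) = 0.
Proof.
  intro Hinf.
  destruct (functional_choice_R (fun l e => exists u, gram_schmidt l u <> zero /\
      e = scal (/ norm (gram_schmidt l u)) (gram_schmidt l u))) as [next Hnext].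
  { intro l; apply NNPP; intro N; apply Hinf.
    exists (length l), (fun k => nth k l (@zero H)); intro u.
    destruct (gram_schmidt_span l u) as [c E]; exists c.
    assert (Z : gram_schmidt l u = zero).
    { apply NNPP; intro Z; apply N; eexists; exists u; split; [exact Z | reflexivity]. }
    rewrite {1}E Z; vec. }
  set (L := fix L n := match n with O => nil | S n => next (L n) :: L n end).
  assert (unit : forall l, inner (next l) (next l) = 1).
  { intro l; destruct (Hnext l) as [u [N ->]].
    rewrite inner_scal_l inner_scal_r -norm_sqr; field.
    apply Rgt_not_eq, norm_pos_neq, N. }
  assert (orth : forall l f, orthonormal l -> In f l -> inner (next l) f = 0).
  { intros l f O I; destruct (Hnext l) as [u [N ->]].
    rewrite inner_scal_l gram_schmidt_orth //; ring. }
  assert (ON : forall n, orthonormal (L n)).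
  { induction n; simpl; auto. }
  assert (mem : forall m n, (m < n)%nat -> In (next (L m)) (L n)).
  { intros m n; induction n as [| n IH]; [lia |]; intro Hmn; simpl.
    destruct (Nat.eq_dec m n) as [-> |]; [now left | right; apply IH; lia]. }
  exists (fun n => next (L n)); split; [auto |]; intros m n Hmn.
  apply orth; auto.
Qed.

End GramSchmidt.

(** * Compactness of graph-bounded sequences and the bottom of the high spectrum *)

Section LowestHighEigenvalue.
Context {H : HilbertSpace} {D : H -> Prop} {A : H -> H}.
Context (Hinf : infinite_dimensional H).
Context (Asa : self_adjoint D A) (Ann : nonnegative D A) (Acr : compact_resolvent D A).
Context (Lam : R) (Lam_pos : 0 < Lam).
Context {P : H -> H} (P_spec : is_spectral_projection D A Lam P).
Local Notation X := (closed_span (low_eigenvector D A Lam)).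
Local Notation Q := (complement P).

(* The resolvent maps the domain vectors bounded in graph norm to a compact set. *)
Lemma graph_bounded_cluster (x : nat -> H) (c : R) :
  (forall n, D (x n)) -> (forall n, norm (x n) <= c) -> (forall n, norm (A (x n)) <= c) ->
  exists y, forall r N, 0 < r -> exists n, (N <= n)%nat /\ norm (minus (x n) y) < r.
Proof.
  intros Dx Bx BA.
  destruct Acr as [lam0 [K [_ [KA [LK [C [CC HC]]]]]]].
  (* [rho] dominates |(A - lam0) x_n|, so x_n / rho is the image under K of a vector in the unit
     ball. *)
  set (rho := (1 + Rabs lam0) * (Rabs c + 1)).
  pose proof (Rabs_pos lam0); pose proof (Rle_abs c); pose proof (Rabs_pos c).
  assert (rpos : 0 < rho) by (unfold rho; nra).
  destruct (compact_cluster C (fun n => scal (/ rho) (x n)) CC) as [y Hy].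
  { intro n; rewrite -{1}(KA (x n)) // -(linear_scal _ LK); apply HC.
    rewrite norm_scal_eq Rabs_inv (Rabs_pos_eq rho); [| lra].
    apply Rmult_le_reg_l with rho; [exact rpos |].
    rewrite -Rmult_assoc Rinv_r; [| lra].
    rewrite Rmult_1_l Rmult_1_r.
    eapply Rle_trans; [apply norm_minus_le |]; rewrite norm_scal_eq.
    specialize (Bx n); specialize (BA n); pose proof (norm_nonneg (x n)).
    unfold rho; nra. }
  exists (scal rho y); intros r N Hr.
  destruct (Hy (r / rho) N) as [n [Hn G]]; [now apply Rdiv_lt_0_compat |].
  exists n; split; [exact Hn |].
  replace (minus (x n) (scal rho y)) with (scal rho (minus (scal (/ rho) (x n)) y))
    by (vec_field; lra).
  rewrite norm_scal_eq (Rabs_pos_eq rho); [| lra].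
  replace r with (rho * (r / rho)) by (field; lra).
  now apply Rmult_lt_compat_l.
Qed.

(** Otherwise A would be bounded by Lam on all of H and an orthonormal sequence would be bounded in
    graph norm. It would then have a cluster point, with two members at distance below 1, although
    orthonormal vectors are at distance sqrt 2. *)
Lemma high_nontrivial : exists u, range Q u /\ u <> zero.
Proof.
  apply NNPP; intro N.
  assert (full : forall u, X u).
  { intro u; assert (Z : Q u = zero).
    { apply NNPP; intro Z; apply N; exists (Q u); split; [apply compl_range | exact Z]. }
    unfold complement in Z; apply eq_of_minus_zero in Z.
    rewrite Z; apply (proj_in Lam P_spec). }
  destruct (orthonormal_sequence Hinf) as [e [E1 E0]].
  assert (Ne : forall n, norm (e n) = 1).
  { intro n; rewrite norm_inner E1; apply sqrt_1. }
  destruct (graph_bounded_cluster e (1 + Lam)) as [y Hy].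
  - intro n; apply (low_closure Asa Lam Lam_pos _ (full (e n))).
  - intro n; rewrite Ne; lra.
  - intro n; destruct (low_closure Asa Lam Lam_pos _ (full (e n))) as [_ [B _]].
    rewrite Ne in B; lra.
  - destruct (Hy (/ 2) 0%nat) as [n [_ Hn]]; [lra |].
    destruct (Hy (/ 2) (S n)) as [m [Hm Hm']]; [lra |].
    pose proof (norm_minus_triangle (e m) y (e n)) as T.
    rewrite (norm_minus_sym y) in T.
    pose proof (norm_sqr (minus (e m) (e n))) as S; inner_expand_in S.
    rewrite !E1 (inner_sym _ (e n) (e m)) E0 in S; [| lia].
    pose proof (norm_nonneg (minus (e m) (e n))); fold_ops; nra.
Qed.

(* With B = (A + 1)^-1 and s the supremum of <Bf, f> on the unit sphere of the range
   of Q, a maximizing sequence has |B f_n - s f_n| -> 0, so that a cluster point of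
   B f_n is an eigenvector. *)
Lemma high_lowest_eigenvector : exists m e,
  range Q e /\ D e /\ e <> zero /\ A e = scal m e /\
  forall u, range Q u -> D u -> m * inner u u <= inner (A u) u.
Proof.
  pose proof (range_compl (D := D) (A := A) Lam P_spec) as RQ.
  destruct (functional_choice_R _ (one_plus_solve Asa Ann)) as [B HB].
  assert (inj : forall u v, D u -> D v -> plus (A u) u = plus (A v) v -> u = v).
  { intros u v Du Dv E; apply eq_of_minus_zero; apply: norm_eq_zero.
    apply Rle_antisym; [| apply norm_nonneg].
    eapply Rle_trans; [apply (one_plus_coercive Ann), (dom_minus Asa); assumption |].
    rewrite (op_minus Asa) //.
    rewrite (_ : plus (minus (A u) (A v)) (minus u v) =
      minus (plus (A u) u) (plus (A v) v)); [| vec].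
    rewrite E norm_minus_self; lra. }
  assert (DB : forall f, D (B f)) by apply HB.
  assert (AB : forall f, A (B f) = minus f (B f)).
  { intro f; rewrite -{2}(proj2 (HB f)); vec. }
  assert (BA : forall u, D u -> B (plus (A u) u) = u).
  { intros u Du; apply inj; auto; apply HB. }
  assert (Bminus : forall f g : H, B (minus f g) = minus (B f) (B g)).
  { intros f g; apply inj; [auto | now apply (dom_minus Asa) |].
    rewrite (op_minus Asa) // !AB; vec. }
  assert (Bscal : forall (a : R) (f : H), B (scal a f) = scal a (B f)).
  { intros a f; apply inj; [auto | now apply (dom_scal _ _ (sa_linear Asa)) |].
    rewrite (op_scal _ _ (sa_linear Asa)) // !AB; vec. }
  assert (Bsym : forall f g, inner (B f) g = inner f (B g)).
  { intros f g; pose proof (sa_symmetric Asa (B f) (B g) (DB f) (DB g)) as S.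
    rewrite !AB in S; inner_expand_in S; lra. }
  assert (Bpos : forall f, inner (B f) (B f) <= inner (B f) f).
  { intro f; pose proof (Ann (B f) (DB f)) as G; rewrite AB in G.
    inner_expand_in G; rewrite (inner_sym _ f) in G; lra. }
  assert (Bnorm : forall f, norm (B f) <= norm f).
  { intro f; pose proof (one_plus_coercive Ann (B f) (DB f)) as G.
    now rewrite (proj2 (HB f)) in G. }
  (* Since P commutes with A, x = P (B f) solves A x + x = P f = 0. *)
  assert (BQ : forall f, range Q f -> range Q (B f)).
  { intros f Rf; apply RQ; apply RQ in Rf.
    pose proof (proj_dom Asa Lam Lam_pos P_spec (B f)) as DP.
    pose proof (one_plus_coercive Ann (P (B f)) DP) as G.
    rewrite -(proj_op Asa Lam Lam_pos P_spec) // AB (proj_minus Lam P_spec) Rf in G.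
    replace (plus (minus zero (P (B f))) (P (B f))) with (@zero H) in G by vec.
    apply: norm_eq_zero; apply Rle_antisym; [| apply norm_nonneg].
    eapply Rle_trans; [exact G |].
    right; rewrite norm_inner; inner_expand.
    replace (_ + _) with 0 by ring; apply sqrt_0. }
  destruct high_nontrivial as [q [Rq Nq]].
  assert (Rscal : forall (a : R) u, range Q u -> range Q (scal a u)).
  { intros a u Ru; apply RQ in Ru; apply RQ.
    rewrite (proj_scal Lam P_spec) Ru; vec. }
  assert (normalize : forall f : H, f <> zero ->
      inner (scal (/ norm f) f) (scal (/ norm f) f) = 1).
  { intros f Nf; inner_expand; rewrite -norm_sqr; field.
    apply Rgt_not_eq, norm_pos_neq, Nf. }
  destruct (real_sup (fun x => exists f, range Q f /\ inner f f = 1 /\ x = inner (B f) f))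
    as [s [Us As]].
  { eexists; exists (scal (/ norm q) q); repeat split; auto. }
  { exists 1; intros x [f [_ [F ->]]].
    eapply Rle_trans; [apply cauchy_schwarz |].
    rewrite -F -norm_sqr; apply Rmult_le_compat_r; [apply norm_nonneg | apply Bnorm]. }
  assert (sbound : forall f, range Q f -> inner (B f) f <= s * inner f f).
  { intros f Rf; destruct (classic (f = zero)) as [-> | Nf].
    { rewrite !inner_zero_r; lra. }
    pose proof (norm_pos_neq f Nf) as Pf.
    assert (G : inner (B (scal (/ norm f) f)) (scal (/ norm f) f) <= s).
    { apply Us; exists (scal (/ norm f) f); auto. }
    rewrite Bscal in G; inner_expand_in G; rewrite -norm_sqr.
    apply (Rmult_le_compat_r (norm f * norm f)) in G; [| nra].
    eapply Rle_trans; [right | exact G]; field; lra. }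
  assert (spos : 0 < s).
  { apply Rnot_le_lt; intro Hs; apply Nq.
    assert (Z : B q = zero).
    { apply inner_definite; pose proof (Bpos q); pose proof (sbound q Rq).
      pose proof (inner_ge_0 _ q); pose proof (inner_ge_0 _ (B q)); nra. }
    rewrite -(proj2 (HB q)) Z (op_zero Asa); vec. }
  (* This is B^2 <= s B, from the positivity of B at f - B f / s and the bound <B g, g> <= s |g|^2
     at g = B f. It gives both the convergence of |B f_n - s f_n| to 0 and, for f = A u + u, the
     final form bound. *)
  assert (Bsqr : forall f, range Q f -> inner (B f) (B f) <= s * inner (B f) f).
  { intros f Rf.
    pose proof (sbound (B f) (BQ f Rf)) as G.
    pose proof (Bpos (minus f (scal (/ s) (B f)))) as G2.
    pose proof (inner_ge_0 _ (B (minus f (scal (/ s) (B f))))) as G3.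
    assert (G4 : 0 <= inner (B (minus f (scal (/ s) (B f)))) (minus f (scal (/ s) (B f)))) by lra.
    rewrite Bminus Bscal in G4; inner_expand_in G4.
    rewrite (Bsym (B f) f) in G4.
    assert (G5 : / s * (/ s * inner (B (B f)) (B f)) <= / s * inner (B f) (B f)).
    { apply Rmult_le_compat_l; [apply Rlt_le, Rinv_0_lt_compat, spos |].
      apply Rmult_le_reg_l with s; [exact spos |].
      rewrite -Rmult_assoc Rinv_r; [lra | lra]. }
    assert (G6 : / s * inner (B f) (B f) <= inner (B f) f) by lra.
    apply (Rmult_le_compat_l s) in G6; [| lra].
    rewrite -Rmult_assoc Rinv_r in G6; lra. }
  destruct (functional_choice_R (fun (n : nat) f => range Q f /\ inner f f = 1 /\
      s - / (INR n + 1) < inner (B f) f)) as [f Hf].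
  { intro n; destruct (As (/ (INR n + 1))) as [x [[f [Rf [F ->]]] G]].
    - apply Rinv_0_lt_compat; pose proof (pos_INR n); lra.
    - exists f; auto. }
  assert (Nf : forall n, norm (f n) = 1).
  { intro n; destruct (Hf n) as [_ [F _]]; rewrite norm_inner F; apply sqrt_1. }
  destruct (graph_bounded_cluster (fun n => B (f n)) 2) as [y Hy].
  { auto. }
  { intro n; specialize (Bnorm (f n)); rewrite Nf in Bnorm; lra. }
  { intro n; rewrite AB; eapply Rle_trans; [apply norm_minus_le |].
    specialize (Bnorm (f n)); rewrite Nf in Bnorm |- *; lra. }
  assert (near : forall r, 0 < r -> exists n, norm (minus (B (f n)) y) <= r /\
      norm (minus (B (f n)) (scal s (f n))) <= r /\ s - r <= norm (B (f n))).
  { intros r Hr.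
    (* By B^2 <= s B, |B f_n - s f_n|^2 <= s (s - <B f_n, f_n>) <= s / (n + 1), hence the threshold
       r^2 / s. *)
    destruct (inv_INR_small (r * r / s)) as [N1 HN1]; [apply Rdiv_lt_0_compat; nra |].
    destruct (inv_INR_small r Hr) as [N2 HN2].
    destruct (Hy r (max N1 N2) Hr) as [n [Hn G]].
    specialize (HN1 n ltac:(lia)); specialize (HN2 n ltac:(lia)).
    destruct (Hf n) as [Rf [F1 F2]]; exists n; split; [lra |]; split.
    - apply norm_le_sqr; [lra |].
      pose proof (Bsqr (f n) Rf); inner_expand.
      rewrite (inner_sym _ (f n) (B (f n))) F1.
      apply (Rmult_le_compat_l s) in HN1; [| lra].
      replace (s * (r * r / s)) with (r * r) in HN1 by (field; lra).
      nra.
    - pose proof (cauchy_schwarz (B (f n)) (f n)) as CS; rewrite Nf in CS; lra. }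
  assert (By : B y = scal s y).
  { apply norm_small_eq; intros r Hr.
    (* The three errors in the decomposition below carry the weights 1, 1 and s. *)
    destruct (near (r / (2 + s))) as [n [N1 [N2 _]]]; [apply Rdiv_lt_0_compat; lra |].
    replace (minus (B y) (scal s y)) with
      (plus (minus (B y) (B (B (f n))))
        (plus (minus (B (B (f n))) (scal s (B (f n)))) (scal s (minus (B (f n)) y)))) by vec.
    rewrite -Bscal -!Bminus.
    eapply Rle_trans; [apply norm_plus_le |].
    pose proof (Bnorm (minus y (B (f n)))) as T1; rewrite (norm_minus_sym y) in T1.
    pose proof (norm_plus_le (B (minus (B (f n)) (scal s (f n))))
      (scal s (minus (B (f n)) y))) as T2.
    rewrite norm_scal_eq (Rabs_pos_eq s) in T2; [| lra].
    pose proof (Bnorm (minus (B (f n)) (scal s (f n)))) as T3.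
    apply (Rmult_le_compat_l s) in N1 as T4; [| lra].
    assert (r = r / (2 + s) + (r / (2 + s) + s * (r / (2 + s)))) by (field; lra).
    fold_ops; lra. }
  assert (Ry : range Q y).
  { apply RQ; apply norm_small_eq; intros r Hr.
    destruct (near r Hr) as [n [N1 _]].
    assert (Z : P (B (f n)) = zero) by (apply RQ, BQ, Hf).
    rewrite -Z -(proj_minus Lam P_spec).
    eapply Rle_trans; [apply (proj_norm Lam P_spec) |].
    now rewrite norm_minus_sym. }
  assert (Ny : y <> zero).
  { intros ->; destruct (near (s / 3)) as [n [N1 [_ N3]]]; [lra |].
    pose proof (norm_le_plus_minus (B (f n)) (@zero H)) as T; rewrite norm_zero in T.
    fold_ops; lra. }
  assert (Ey : y = scal (/ s) (B y)) by (rewrite By; vec_field; lra).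
  (* An eigenvalue m of A corresponds to the eigenvalue s = 1 / (1 + m) of (A + 1)^-1. *)
  exists (/ s - 1), y; split; [exact Ry | split; [| split; [exact Ny | split]]].
  - rewrite Ey; now apply (dom_scal _ _ (sa_linear Asa)).
  - rewrite {1}Ey (op_scal _ _ (sa_linear Asa)) // AB By; vec_field; lra.
  - intros u Ru Du.
    assert (Rf : range Q (plus (A u) u)).
    { apply RQ; rewrite (proj_plus Lam P_spec) (proj_op Asa Lam Lam_pos P_spec) //.
      rewrite (proj1 (RQ u) Ru) (op_zero Asa); vec. }
    pose proof (Bsqr _ Rf) as G; rewrite BA // in G; inner_expand_in G.
    apply (Rmult_le_compat_l (/ s)) in G; [| apply Rlt_le, Rinv_0_lt_compat, spos].
    rewrite -Rmult_assoc Rinv_l in G; [| lra].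
    rewrite (inner_sym _ u) in G; lra.
Qed.

Lemma lambda_plus_spec : Lam < lambda_plus D A P /\
  forall u, range Q u -> D u -> lambda_plus D A P * inner u u <= inner (A u) u.
Proof.
  destruct high_lowest_eigenvector as [m [e [Re [De [Ne [Ae form]]]]]].
  assert (E : lambda_plus D A P = m).
  { unfold lambda_plus.
    rewrite (is_glb_Rbar_unique _ (Finite m)); [reflexivity |].
    split.
    - intros lam S; simpl; apply Rnot_lt_le; intro Hlt; apply S.
      now apply (high_resolvent Asa Lam Lam_pos P_spec m).
    (* The infimum is attained: an eigenvector violates the norm bound required of a resolvent
       point, so m belongs to the spectrum. *)
    - intros b Hb; apply Hb; intros [_ [C HC]].
      specialize (HC e Re De); rewrite Ae norm_minus_self Rmult_0_r in HC.
      pose proof (norm_pos_neq e Ne); lra. }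
  rewrite E; split; [| exact form].
  apply Rnot_le_lt; intro Hm; apply Ne, inner_definite.
  apply (compl_orth Lam P_spec); [exact Re |].
  apply closed_span_incl; replace e with (scal 1 e) by vec; apply span_single.
  split; [exact De |]; exists m; split; [split; [| exact Hm] | exact Ae].
  pose proof (Ann e De) as G; rewrite Ae inner_scal_l -norm_sqr in G.
  pose proof (norm_pos_neq e Ne) as Pe.
  apply Rmult_le_reg_r with (norm e * norm e); [now apply Rmult_lt_0_compat |].
  now rewrite Rmult_0_l.
Qed.

Lemma gamma_ge (eps : R) : / eps <= gamma D A P eps.
Proof.
  unfold gamma, alpha; destruct lambda_plus_spec as [G _].
  pose proof (beta_le Asa Lam Lam_pos P_spec); lra.
Qed.

End LowestHighEigenvalue.

(** * Calculus of Hilbert-valued functions *)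

Lemma locally_R (t : R) (Q : R -> Prop) :
  locally t Q <-> exists d, 0 < d /\ forall s, Rabs (s - t) < d -> Q s.
Proof.
  split.
  - intros [d Hd]; exists d; split; [apply cond_pos |].
    intros s Hs; apply Hd; exact Hs.
  - intros [d [Hd HQ]]; exists (mkposreal d Hd); intros s Hs; apply HQ; exact Hs.
Qed.

Section Calculus.
Context {H : HilbertSpace}.

Lemma filterlim_eps {T : Type} (F : (T -> Prop) -> Prop) {FF : Filter F} (f : T -> H) (l : H) :
  filterlim f F (locally l) <-> forall r, 0 < r -> F (fun t => norm (minus (f t) l) < r).
Proof.
  split.
  - intros L r Hr; exact (proj1 (filterlim_locally_ball_norm f l) L (mkposreal r Hr)).
  - intro L; apply (proj2 (filterlim_locally_ball_norm f l)); intros [r Hr]; exact (L r Hr).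
Qed.

Lemma continuous_eps (f : R -> H) (t : R) : continuous f t <->
  forall r, 0 < r -> exists d, 0 < d /\ forall s, Rabs (s - t) < d ->
    norm (minus (f s) (f t)) < r.
Proof.
  unfold continuous; rewrite filterlim_eps; split.
  - intros L r Hr; apply locally_R; auto.
  - intros L r Hr; apply locally_R; auto.
Qed.

Lemma is_derive_eps (f : R -> H) (t : R) (l : H) : is_derive f t l <->
  forall r, 0 < r -> exists d, 0 < d /\ forall s, Rabs (s - t) < d ->
    norm (minus (minus (f s) (f t)) (scal (s - t) l)) <= r * Rabs (s - t).
Proof.
  split.
  - intros [_ DF] r Hr; specialize (DF t (fun P HP => HP) (mkposreal r Hr)).
    apply locally_R in DF; exact DF.
  - intro DF; split; [apply: is_linear_scal_l |].
    intros x Hx; rewrite -(@is_filter_lim_locally_unique R_AbsRing R_NormedModule t x Hx).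
    intros [r Hr]; apply locally_R; exact (DF r Hr).
Qed.

Lemma is_derive_inner (f : R -> H) (t : R) (l e : H) :
  is_derive f t l -> is_derive (fun s => inner (f s) e) t (inner l e).
Proof.
  intro DF; apply is_derive_Reals; intros r Hr.
  destruct (proj1 (is_derive_eps f t l) DF (r / (2 * (norm e + 1)))) as [d [Hd HD]].
  { pose proof (norm_nonneg e); apply Rdiv_lt_0_compat; lra. }
  exists (mkposreal d Hd); intros k Hk Hkd; simpl in Hkd.
  specialize (HD (t + k)); replace (t + k - t) with k in HD by ring.
  specialize (HD Hkd).
  apply Rmult_lt_reg_r with (Rabs k); [now apply Rabs_pos_lt |].
  rewrite -Rabs_mult.
  replace (((inner (f (t + k)) e - inner (f t) e) / k - inner l e) * k)
    with (inner (minus (minus (f (t + k)) (f t)) (scal k l)) e)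
    by (inner_expand; field; exact Hk).
  eapply Rle_lt_trans; [apply cauchy_schwarz_abs |].
  pose proof (norm_nonneg e); pose proof (Rabs_pos_lt k Hk).
  apply Rle_lt_trans with (r / (2 * (norm e + 1)) * Rabs k * norm e).
  { apply Rmult_le_compat_r; [assumption | exact HD]. }
  replace (r / (2 * (norm e + 1)) * Rabs k * norm e)
    with (r * Rabs k * (norm e / (2 * (norm e + 1)))) by (field; lra).
  rewrite -{2}(Rmult_1_r (r * Rabs k)).
  apply Rmult_lt_compat_l; [nra |].
  apply Rmult_lt_reg_r with (2 * (norm e + 1)); [lra |].
  unfold Rdiv; rewrite Rmult_assoc Rinv_l; lra.
Qed.

Lemma is_derive_sqr (f : R -> H) (t : R) (l : H) :
  is_derive f t l -> is_derive (fun s => inner (f s) (f s)) t (2 * inner l (f t)).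
Proof.
  intro DF; apply is_derive_Reals; intros r Hr.
  pose proof (norm_nonneg (f t)); pose proof (norm_nonneg l).
  destruct (proj1 (is_derive_eps f t l) DF 1) as [d1 [Hd1 HD1]]; [lra |].
  destruct (proj1 (is_derive_eps f t l) DF (r / (4 * (norm (f t) + 1)))) as [d2 [Hd2 HD2]].
  { apply Rdiv_lt_0_compat; lra. }
  (* Near t the increment v satisfies |v| <= (1 + |l|) |k|, so the quadratic term is at most c
     k^2. *)
  set (c := (1 + norm l) * (1 + norm l)).
  assert (cpos : 0 < c) by (unfold c; nra).
  assert (Hd : 0 < Rmin (Rmin d1 d2) (r / (4 * c))).
  { repeat apply Rmin_glb_lt; auto; apply Rdiv_lt_0_compat; lra. }
  exists (mkposreal _ Hd); intros k Hk Hkd; simpl in Hkd.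
  apply Rmin_Rgt_l in Hkd as [Hkd Hk3]; apply Rmin_Rgt_l in Hkd as [Hk1 Hk2].
  specialize (HD1 (t + k)); specialize (HD2 (t + k)).
  replace (t + k - t) with k in HD1, HD2 by ring.
  specialize (HD1 Hk1); specialize (HD2 Hk2).
  pose proof (Rabs_pos_lt k Hk) as Pk.
  set (v := minus (f (t + k)) (f t)) in *.
  assert (Nv : norm v <= (1 + norm l) * Rabs k).
  { pose proof (norm_le_plus_minus v (scal k l)) as T; rewrite norm_scal_eq in T.
    fold_ops; lra. }
  apply Rmult_lt_reg_r with (Rabs k); [exact Pk |].
  rewrite -Rabs_mult.
  replace (((inner (f (t + k)) (f (t + k)) - inner (f t) (f t)) / k - 2 * inner l (f t)) * k)
    with (inner v v + 2 * inner (minus v (scal k l)) (f t)).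
  2:{ unfold v; inner_expand; rewrite (inner_sym _ (f t) (f (t + k))); field; exact Hk. }
  eapply Rle_lt_trans; [apply Rabs_triang |].
  rewrite Rabs_mult (Rabs_pos_eq 2); [| lra].
  rewrite Rabs_pos_eq; [| apply inner_ge_0].
  pose proof (cauchy_schwarz_abs (minus v (scal k l)) (f t)) as CS.
  rewrite -norm_sqr.
  assert (B1 : norm v * norm v <= c * Rabs k * Rabs k).
  { unfold c; pose proof (norm_nonneg v).
    apply Rle_trans with ((1 + norm l) * Rabs k * ((1 + norm l) * Rabs k)); [| right; ring].
    apply Rmult_le_compat; assumption. }
  assert (B2 : c * Rabs k * Rabs k <= r / 4 * Rabs k).
  { apply Rmult_le_compat_r; [lra |].
    apply Rle_trans with (c * (r / (4 * c))); [apply Rmult_le_compat_l; lra |].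
    right; field; lra. }
  assert (B3 : norm (minus v (scal k l)) * norm (f t) <= r / 4 * Rabs k).
  { apply Rle_trans with (r / (4 * (norm (f t) + 1)) * Rabs k * (norm (f t) + 1)).
    - apply Rmult_le_compat; [apply norm_nonneg | apply norm_nonneg | exact HD2 | lra].
    - right; field; lra. }
  fold_ops; nra.
Qed.

Lemma is_derive_contraction (f g : R -> H) (B : H -> H) (t : R) (l : H) :
  (forall u v, B (minus u v) = minus (B u) (B v)) ->
  (forall (a : R) u, B (scal a u) = scal a (B u)) ->
  (forall u, norm (B u) <= norm u) ->
  is_derive f t l -> is_derive (fun s => B (f s)) t (B l).
Proof.
  intros Bm Bs Bn DF; apply is_derive_eps; intros r Hr.
  destruct (proj1 (is_derive_eps f t l) DF r Hr) as [d [Hd HD]].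
  exists d; split; [exact Hd |]; intros s Hs.
  rewrite -Bs -!Bm; eapply Rle_trans; [apply Bn | auto].
Qed.

Lemma Riemann_sum_linear (B : H -> H) (f : R -> H) (s : SF_seq) :
  is_linear B -> Riemann_sum (fun t => B (f t)) s = B (Riemann_sum f s).
Proof.
  intro LB; apply SF_cons_ind with (s := s); clear s.
  - intro x; unfold Riemann_sum; simpl; symmetry.
    replace (@zero H) with (scal 0 (@zero H)) at 1 by vec.
    rewrite (linear_scal _ LB); vec.
  - intros x s IH; rewrite !Riemann_sum_cons IH (linear_plus _ LB) (linear_scal _ LB) //.
Qed.

Lemma is_RInt_linear (B : H -> H) (f : R -> H) (a b : R) (I : H) :
  is_linear B -> is_RInt f a b I -> is_RInt (fun t => B (f t)) a b (B I).
Proof.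
  intros LB HI; unfold is_RInt.
  apply filterlim_ext with (fun s => B (scal (sign (b - a)) (Riemann_sum f s))).
  - intro s; now rewrite (linear_scal _ LB) Riemann_sum_linear.
  - eapply filterlim_comp; [exact HI |].
    exact (linear_cont B I LB).
Qed.

Lemma Riemann_sum_inner (e : H) (f : R -> H) (s : SF_seq) :
  Riemann_sum (fun t => inner (f t) e : R) s = inner (Riemann_sum f s) e.
Proof.
  apply SF_cons_ind with (s := s); clear s.
  - intro x; unfold Riemann_sum; simpl; now rewrite inner_zero_l.
  - intros x s IH; rewrite !Riemann_sum_cons IH inner_plus_l inner_scal_l //.
Qed.

Lemma is_RInt_inner (e : H) (f : R -> H) (a b : R) (I : H) :
  is_RInt f a b I -> is_RInt (fun t => inner (f t) e) a b (inner I e).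
Proof.
  intros HI; unfold is_RInt.
  apply filterlim_ext with (fun s => inner (scal (sign (b - a)) (Riemann_sum f s)) e).
  - intro s; now rewrite inner_scal_l Riemann_sum_inner.
  - refine (filterlim_comp _ _ _ _ (fun u : H => inner u e) _ _ _ HI _).
    apply filterlim_locally; intros [r Hr]; simpl.
    pose proof (norm_nonneg e).
    assert (G : 0 < r / (norm e + 1)) by (apply Rdiv_lt_0_compat; lra).
    pose proof (locally_ball_norm I (mkposreal _ G)) as L.
    eapply filter_imp; [| exact L].
    intros u Hu; change (norm (minus (u : H) I) < r / (norm e + 1)) in Hu.
    change (Rabs (inner u e - inner I e) < r).
    rewrite -inner_minus_l; eapply Rle_lt_trans; [apply cauchy_schwarz_abs |].
    apply Rle_lt_trans with (norm (minus (u : H) I) * (norm e + 1)).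
    { apply Rmult_le_compat_l; [apply norm_nonneg | lra]. }
    apply Rlt_le_trans with (r / (norm e + 1) * (norm e + 1)).
    { apply Rmult_lt_compat_r; [lra | exact Hu]. }
    right; field; lra.
Qed.

End Calculus.

(** The product exp (k s) (f s - K) is nonincreasing. Differentiability is asked only for s > 0,
    with continuity from the right at 0, because that is what orbits provide; k may have any
    sign. *)
Lemma gronwall (f : R -> R) (k K t : R) : 0 <= t ->
  (forall s, 0 < s -> exists l, is_derive f s l /\ l <= - k * (f s - K)) ->
  (forall r, 0 < r -> exists d, 0 < d /\ forall s, 0 <= s < d -> Rabs (f s - f 0) <= r) ->
  f t <= K + exp (- (k * t)) * (f 0 - K).
Proof.
  intros Ht DF CF.
  destruct (functional_choice_R (fun s l => 0 < s -> is_derive f s l /\ l <= - k * (f s - K)))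
    as [f' Hf'].
  { intro s; destruct (Rlt_dec 0 s) as [G | G].
    - destruct (DF s G) as [l Hl]; now exists l.
    - exists 0; tauto. }
  (* Freezing f at its value f 0 for negative times gives the two-sided continuity at 0 that the
     mean value theorem asks for. *)
  set (F := fun s => f (Rmax 0 s)).
  set (G := fun s => exp (k * s) * (F s - K)).
  assert (DG : forall s, 0 < s -> is_derive G s (exp (k * s) * (k * (f s - K) + f' s))).
  { intros s Hs; destruct (Hf' s Hs) as [D _].
    apply is_derive_ext_loc with (fun s => exp (k * s) * (f s - K)).
    - apply locally_R; exists s; split; [exact Hs |]; intros x Hx.
      unfold G, F; rewrite Rmax_right //.
      apply Rabs_def2 in Hx; lra.
    - auto_derive; [now exists (f' s) |].
      rewrite (is_derive_unique _ _ _ D); ring. }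
  assert (CG : forall s, 0 <= s -> continuity_pt G s).
  { intros s [Hs | <-].
    - apply derivable_continuous_pt; eexists; apply is_derive_Reals, (DG s Hs).
    - apply continuity_pt_mult.
      + apply derivable_continuous_pt; reg.
      + apply continuity_pt_minus; [| now apply continuity_pt_const].
        intros r Hr; destruct (CF (r / 2)) as [d [Hd HD]]; [lra |].
        exists d; split; [exact Hd |]; intros x [_ Hx]; simpl in Hx |- *.
        unfold R_dist in *; rewrite Rminus_0_r in Hx.
        apply Rle_lt_trans with (r / 2); [| lra].
        unfold F; rewrite (Rmax_left 0 0); [| lra].
        apply HD; split; [apply Rmax_l |]; apply Rmax_lub_lt; [lra |].
        apply Rabs_def2 in Hx; lra. }
  assert (mono : G t <= G 0).
  { destruct (MVT_gen G 0 t (fun s => if Rlt_dec 0 s is left _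
       then exp (k * s) * (k * (f s - K) + f' s) else 0)) as [c [_ E]].
    - intros s; rewrite Rmin_left // Rmax_right //; intros [S1 S2].
      destruct (Rlt_dec 0 s); [now apply DG | lra].
    - intros s; rewrite Rmin_left // Rmax_right //; intros [S1 S2]; auto.
    - destruct (Rlt_dec 0 c) as [Hc | Hc]; [| lra].
      destruct (Hf' c Hc) as [_ L].
      assert (exp (k * c) * (k * (f c - K) + f' c) <= 0); [| nra].
      pose proof (exp_pos (k * c)); nra. }
  unfold G, F in mono; rewrite (Rmax_right 0 t) // (Rmax_left 0 0) in mono; [| lra].
  rewrite Rmult_0_r exp_0 in mono.
  apply (Rmult_le_compat_l (exp (- (k * t)))) in mono; [| apply Rlt_le, exp_pos].
  rewrite -Rmult_assoc -exp_plus in mono.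
  replace (- (k * t) + k * t) with 0 in mono by ring.
  rewrite exp_0 in mono; lra.
Qed.

(** * The semigroup of A *)

Lemma at_right_zero (Q : R -> Prop) :
  at_right 0 Q <-> exists d, 0 < d /\ forall s, 0 < s < d -> Q s.
Proof.
  unfold at_right, within; rewrite locally_R; split; intros [d [Hd HQ]]; exists d;
    split; auto.
  - intros s Hs; apply HQ; [rewrite Rminus_0_r Rabs_pos_eq |]; lra.
  - intros s Hs Ps; rewrite Rminus_0_r in Hs; apply Rabs_def2 in Hs; apply HQ; lra.
Qed.

Section Semigroup.
Context {H : HilbertSpace} {D : H -> Prop} {A : H -> H} {T : R -> H -> H}.
Context (Asa : self_adjoint D A) (T_exp : is_exp_semigroup D A T).

Lemma sg_minus t u v : 0 <= t -> T t (minus u v) = minus (T t u) (T t v).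
Proof.
  intro Ht; pose proof (sg_linear _ _ _ T_exp t Ht) as LT.
  replace (minus u v) with (plus u (scal (-1) v)) by vec.
  rewrite (linear_plus _ LT) (linear_scal _ LT); vec.
Qed.

Lemma sg_scal t (a : R) u : 0 <= t -> T t (scal a u) = scal a (T t u).
Proof. intro Ht; apply (linear_scal _ (sg_linear _ _ _ T_exp t Ht)). Qed.

Lemma sg_cont_eps u r : 0 < r ->
  exists d, 0 < d /\ forall t, 0 <= t < d -> norm (minus (T t u) u) < r.
Proof.
  intro Hr; pose proof (sg_cont _ _ _ T_exp u) as C.
  apply (filterlim_eps (at_right 0)) with (r := r) in C; [| exact Hr].
  apply at_right_zero in C; destruct C as [d [Hd HC]]; exists d; split; [exact Hd |].
  intros t [[Ht | <-] Htd]; [auto |].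
  rewrite (sg_zero _ _ _ T_exp) norm_minus_self; exact Hr.
Qed.

(* Uniform boundedness by nested balls: if no T t with t near 0 is uniformly
   bounded, each ball contains a smaller one on which some T t, with t <= 1/(k+1),
   has norm at least k; a common point u then contradicts T t u -> u. *)
Lemma sg_bound_near_zero : exists d C, 0 < d /\ 0 <= C /\
  forall t u, 0 <= t <= d -> norm (T t u) <= C * norm u.
Proof.
  apply NNPP; intro N.
  assert (large : forall d C, 0 < d -> 0 <= C ->
      exists t u, 0 <= t <= d /\ C * norm u < norm (T t u)).
  { intros d C Hd HC; apply NNPP; intro N'; apply N; exists d, C; repeat split; auto.
    intros t u Ht; apply Rnot_lt_le; intro G; apply N'; exists t, u; auto. }
  assert (step : forall kb : nat * (H * R), exists b' : H * R, 0 < snd (snd kb) ->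
      0 < snd b' /\ snd b' <= snd (snd kb) / 2 /\
      norm (minus (fst b') (fst (snd kb))) <= snd (snd kb) / 2 /\
      exists t, 0 <= t <= / (INR (fst kb) + 1) /\
        forall y, norm (minus y (fst b')) <= snd b' -> INR (fst kb) <= norm (T t y)).
  { intros [k [x r]]; simpl.
    destruct (Rlt_dec 0 r) as [Hr | Hr]; [| exists (x, 1); tauto].
    pose proof (pos_INR k) as Pk.
    (* The factor is chosen so that u, rescaled to length r / 2, has an image of norm above k +
       1. *)
    destruct (large (/ (INR k + 1)) (2 * (INR k + 1) / r)) as [t [u [Ht Hu]]].
    { apply Rinv_0_lt_compat; lra. }
    { apply Rlt_le, Rdiv_lt_0_compat; lra. }
    pose proof (sg_linear _ _ _ T_exp t (proj1 Ht)) as LT.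
    assert (Nu : u <> zero).
    { intros ->; destruct (linear_norm _ LT) as [B [_ TB]]; specialize (TB zero).
      rewrite norm_zero in TB Hu; fold_ops; lra. }
    pose proof (norm_pos_neq u Nu) as Pu.
    set (v := scal (r / 2 / norm u) u).
    assert (Nv : norm v = r / 2).
    { unfold v; rewrite norm_scal_eq Rabs_pos_eq.
      - field; lra.
      - apply Rlt_le, Rdiv_lt_0_compat; lra. }
    assert (Tv : INR k + 1 < norm (T t v)).
    { unfold v; rewrite (linear_scal _ LT) norm_scal_eq Rabs_pos_eq.
      - apply (Rmult_lt_compat_l (r / 2 / norm u)) in Hu; [| apply Rdiv_lt_0_compat; lra].
        eapply Rle_lt_trans; [right | exact Hu]; field; lra.
      - apply Rlt_le, Rdiv_lt_0_compat; lra. }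
    (* The images of x + v and x - v differ by 2 T t v, of norm above 2 (k + 1), so one of them is
       larger than k + 1. *)
    assert (E : exists x', norm (minus x' x) = r / 2 /\ INR k + 1 < norm (T t x')).
    { destruct (Rlt_dec (INR k + 1) (norm (T t (plus x v)))) as [G | G].
      - exists (plus x v); split; [| exact G].
        rewrite (_ : minus (plus x v) x = v) //; vec.
      - exists (minus x v); split.
        + rewrite (_ : minus (minus x v) x = opp v); [now rewrite norm_opp | vec].
        + apply Rnot_lt_le in G.
          pose proof (norm_minus_le (T t (plus x v)) (T t (minus x v))) as Tr.
          rewrite (linear_plus _ LT) sg_minus in Tr G |- *; [| apply Ht].
          rewrite (_ : minus (plus (T t x) (T t v)) (minus (T t x) (T t v))
            = scal 2 (T t v)) in Tr; [| vec].
          rewrite norm_scal_eq Rabs_pos_eq in Tr; [| lra].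
          fold_ops; lra. }
    destruct E as [x' [Ex Tx]].
    destruct (linear_norm _ LT) as [B [HB TB]].
    (* [B] bounds the operator T t, so over a ball of radius 1 / B the norm of the image drops by at
       most 1, from k + 1 to k. *)
    assert (Hr' : 0 < Rmin (r / 2) (/ B)).
    { apply Rmin_glb_lt; [lra | now apply Rinv_0_lt_compat]. }
    exists (x', Rmin (r / 2) (/ B)); simpl; intros _.
    split; [exact Hr' | split; [apply Rmin_l | split; [lra |]]].
    exists t; split; [exact Ht |]; intros y Hy.
    pose proof (TB (minus y x')) as G; rewrite sg_minus in G; [| apply Ht].
    assert (B * norm (minus y x') <= 1).
    { apply Rle_trans with (B * / B); [| right; field; lra].
      apply Rmult_le_compat_l; [lra |].
      eapply Rle_trans; [exact Hy | apply Rmin_r]. }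
    pose proof (norm_le_plus_minus (T t x') (T t y)) as Tr.
    rewrite norm_minus_sym in Tr; fold_ops; lra. }
  destruct (functional_choice_R _ step) as [next Hnext]; clear step.
  set (b := fix b k := match k with O => (@zero H, 1) | S k => next (k, b k) end).
  assert (bpos : forall k, 0 < snd (b k)).
  { induction k as [| k IH]; [simpl; lra |]; apply (Hnext (k, b k)), IH. }
  assert (bstep : forall k, snd (b (S k)) <= snd (b k) / 2 /\
      norm (minus (fst (b (S k))) (fst (b k))) <= snd (b k) / 2 /\
      exists t, 0 <= t <= / (INR k + 1) /\
        forall y, norm (minus y (fst (b (S k)))) <= snd (b (S k)) -> INR k <= norm (T t y)).
  { intro k; apply (Hnext (k, b k)), bpos. }
  clearbody b.
  assert (small : forall k, snd (b k) <= (1 + snd (b O)) * / (INR k + 1)).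
  { induction k as [| k IH].
    - simpl; pose proof (bpos O); rewrite Rplus_0_l Rinv_1; lra.
    - destruct (bstep k) as [G _]; pose proof (pos_INR k); pose proof (bpos O).
      rewrite S_INR; eapply Rle_trans; [exact G |].
      apply Rle_trans with ((1 + snd (b O)) * (/ (INR k + 1) / 2)); [lra |].
      apply Rmult_le_compat_l; [lra |].
      unfold Rdiv; rewrite -Rinv_mult; apply Rinv_le_contravar; lra. }
  assert (nested : forall n j,
      norm (minus (fst (b (n + j)%nat)) (fst (b n))) + snd (b (n + j)%nat) <= snd (b n)).
  { intros n j; induction j as [| j IH].
    - rewrite Nat.add_0_r norm_minus_self; lra.
    - rewrite Nat.add_succ_r; destruct (bstep (n + j)%nat) as [G1 [G2 _]].
      pose proof (norm_minus_triangle (fst (b (S (n + j)))) (fst (b (n + j)%nat)) (fst (b n))).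
      lra. }
  destruct (complete_seq (fun n => fst (b n))) as [u Tu].
  { intros r Hr; pose proof (bpos O).
    destruct (inv_INR_small (r / 2 / (1 + snd (b O)))) as [N1 HN1].
    { repeat apply Rdiv_lt_0_compat; lra. }
    exists N1; intros n m Hn Hm.
    assert (S1 : snd (b N1) <= r / 2).
    { eapply Rle_trans; [apply small |].
      apply Rle_trans with ((1 + snd (b O)) * (r / 2 / (1 + snd (b O))));
        [apply Rmult_le_compat_l; [lra | now apply HN1] | right; field; lra]. }
    pose proof (nested N1 (n - N1)%nat) as G1; pose proof (nested N1 (m - N1)%nat) as G2.
    replace (N1 + (n - N1))%nat with n in G1 by lia.
    replace (N1 + (m - N1))%nat with m in G2 by lia.
    pose proof (bpos n); pose proof (bpos m).
    pose proof (norm_minus_triangle (fst (b n)) (fst (b N1)) (fst (b m))) as Tr.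
    rewrite (norm_minus_sym (fst (b N1)) (fst (b m))) in Tr; lra. }
  assert (inball : forall k, norm (minus u (fst (b k))) <= snd (b k)).
  { intro k; apply (tends_norm_le (fun n => minus (fst (b (k + n)%nat)) (fst (b k)))).
    - intro n; pose proof (nested k n); pose proof (bpos (k + n)%nat); lra.
    - intros r Hr; destruct (Tu r Hr) as [N1 HN1]; exists N1; intros n Hn.
      rewrite (_ : minus (minus (fst (b (k + n)%nat)) (fst (b k))) (minus u (fst (b k)))
        = minus (fst (b (k + n)%nat)) u); [apply HN1; lia | vec]. }
  destruct (sg_cont_eps u 1) as [d [Hd HC]]; [lra |].
  destruct (inv_INR_small (d / 2)) as [N1 HN1]; [lra |].
  destruct (nfloor_ex (norm u + 1)) as [N2 HN2]; [pose proof (norm_nonneg u); lra |].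
  (* This k makes t smaller than d and exceeds |u| + 1, whereas |T t u - u| < 1. *)
  set (k := max N1 (S N2)).
  destruct (bstep k) as [_ [_ [t [Ht HT]]]].
  specialize (HT u (inball (S k))).
  specialize (HN1 k ltac:(lia)).
  specialize (HC t ltac:(lra)).
  assert (GN : INR (S N2) <= INR k) by (apply le_INR; lia).
  rewrite S_INR in GN.
  pose proof (norm_le_plus_minus (T t u) u); fold_ops; lra.
Qed.

Lemma sg_bound (tau : R) : exists C, 0 <= C /\
  forall t u, 0 <= t <= tau -> norm (T t u) <= C * norm u.
Proof.
  destruct sg_bound_near_zero as [d [C [Hd [HC BC]]]].
  assert (G : forall n, exists C', 0 <= C' /\
    forall t u, 0 <= t <= INR n * d -> norm (T t u) <= C' * norm u).
  { induction n as [| n [C' [HC' IH]]].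
    - exists C; split; [exact HC |]; intros t u; simpl; intro Ht; apply BC; lra.
    - exists (C + C * C'); split; [nra |]; intros t u Ht; rewrite S_INR in Ht.
      pose proof (norm_nonneg u).
      assert (0 <= C * C') by nra.
      destruct (Rle_dec t d) as [L | L].
      + eapply Rle_trans; [apply BC; lra |].
        apply Rmult_le_compat_r; lra.
      + replace t with (d + (t - d)) by ring.
        rewrite (sg_plus _ _ _ T_exp); [| lra | lra].
        eapply Rle_trans; [apply BC; lra |].
        apply Rle_trans with (C * (C' * norm u)); [| nra].
        apply Rmult_le_compat_l; [exact HC | apply IH; nra]. }
  destruct (Rle_dec 0 tau) as [L | L].
  - destruct (nfloor_ex (tau / d)) as [n [_ Hn]].
    { unfold Rdiv; apply Rmult_le_pos; [exact L | apply Rlt_le, Rinv_0_lt_compat, Hd]. }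
    destruct (G (S n)) as [C' [HC' B]]; exists C'; split; [exact HC' |].
    intros t u Ht; apply B; rewrite S_INR; split; [lra |].
    apply Rle_trans with (1 := proj2 Ht).
    apply (Rmult_lt_compat_r d) in Hn; [| exact Hd].
    unfold Rdiv in Hn; rewrite Rmult_assoc Rinv_l in Hn; lra.
  - exists 0; split; [lra |]; intros; lra.
Qed.

(** Writing T t u - T s u = T s (T (t - s) u - u), the uniform bound turns continuity from the right
    at 0 into two-sided continuity. *)
Lemma sg_uniform_cont (tau : R) u r : 0 < r -> exists d, 0 < d /\
  forall s t, 0 <= s <= tau -> 0 <= t <= tau -> Rabs (t - s) < d ->
    norm (minus (T t u) (T s u)) <= r.
Proof.
  intro Hr; destruct (sg_bound tau) as [C [HC BC]].
  destruct (sg_cont_eps u (r / (C + 1))) as [d [Hd Hd']]; [apply Rdiv_lt_0_compat; lra |].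
  exists d; split; [exact Hd |].
  assert (W : forall s t, 0 <= s <= tau -> 0 <= t <= tau -> s <= t -> t - s < d ->
      norm (minus (T t u) (T s u)) <= r).
  { intros s t Hs Ht Hst Htd.
    replace t with (s + (t - s)) by ring; rewrite (sg_plus _ _ _ T_exp); [| lra | lra].
    rewrite -sg_minus; [| lra].
    eapply Rle_trans; [now apply BC |].
    specialize (Hd' (t - s) ltac:(lra)).
    pose proof (norm_nonneg (minus (T (t - s) u) u)).
    apply Rle_trans with ((C + 1) * (r / (C + 1))); [| right; field; lra].
    apply Rmult_le_compat; lra. }
  intros s t Hs Ht Hst; apply Rabs_def2 in Hst.
  destruct (Rle_dec s t); [apply W; lra | rewrite norm_minus_sym; apply W; lra].
Qed.

Lemma sg_quotient w r : D w -> 0 < r -> exists d, 0 < d /\ forall k, 0 <= k < d ->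
  norm (plus (minus (T k w) w) (scal k (A w))) <= r * k.
Proof.
  intros Dw Hr.
  destruct (sg_generator _ _ _ T_exp w (opp (A w))) as [G _].
  specialize (G (conj Dw eq_refl)).
  apply (filterlim_eps (at_right 0)) with (r := r) in G; [| exact Hr].
  apply at_right_zero in G; destruct G as [d [Hd HG]]; exists d; split; [exact Hd |].
  intros k [[Hk | <-] Hkd].
  - rewrite (_ : plus (minus (T k w) w) (scal k (A w)) =
      scal k (minus (scal (/ k) (minus (T k w) w)) (opp (A w)))); [| vec_field; lra].
    rewrite norm_scal_eq Rabs_pos_eq; [| lra].
    rewrite Rmult_comm; apply Rmult_le_compat_r; [lra |].
    apply Rlt_le, HG; lra.
  - rewrite (sg_zero _ _ _ T_exp) Rmult_0_r.
    rewrite (_ : plus (minus w w) (scal 0 (A w)) = minus w w); [| vec].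
    rewrite norm_minus_self; lra.
Qed.

(** T t commutes with the difference quotients at 0, so those of T t w converge, and the generator
    clause reads off both the domain and the value. *)
Lemma sg_dom t w : 0 <= t -> D w -> D (T t w) /\ A (T t w) = T t (A w).
Proof.
  intros Ht Dw.
  destruct (sg_generator _ _ _ T_exp (T t w) (opp (T t (A w)))) as [_ G].
  destruct G as [DT E].
  - apply (filterlim_eps (at_right 0)); intros r Hr; apply at_right_zero.
    destruct (sg_bound t) as [C [HC BC]].
    destruct (sg_quotient w (r / 2 / (C + 1)) Dw) as [d [Hd Q]].
    { repeat apply Rdiv_lt_0_compat; lra. }
    exists d; split; [exact Hd |]; intros k Hk; specialize (Q k ltac:(lra)).
    rewrite -(sg_plus _ _ _ T_exp) ?(Rplus_comm k t) ?(sg_plus _ _ _ T_exp); try lra.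
    rewrite (_ : minus (scal (/ k) (minus (T t (T k w)) (T t w))) (opp (T t (A w)))
      = scal (/ k) (T t (plus (minus (T k w) w) (scal k (A w))))).
    2:{ rewrite (linear_plus _ (sg_linear _ _ _ T_exp t Ht)) sg_minus // sg_scal //.
        vec_field; lra. }
    rewrite norm_scal_eq Rabs_pos_eq; [| apply Rlt_le, Rinv_0_lt_compat; lra].
    apply Rle_lt_trans with (/ k * ((C + 1) * (r / 2 / (C + 1) * k))).
    + apply Rmult_le_compat_l; [apply Rlt_le, Rinv_0_lt_compat; lra |].
      eapply Rle_trans; [apply BC; lra |].
      apply Rmult_le_compat; [exact HC | apply norm_nonneg | lra | exact Q].
    + replace (/ k * ((C + 1) * (r / 2 / (C + 1) * k))) with (r / 2) by (field; lra); lra.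
  - split; [exact DT |].
    rewrite (_ : A (T t w) = opp (opp (A (T t w)))); [| vec].
    rewrite -E; vec.
Qed.

Lemma sg_derive t w : 0 < t -> D w -> is_derive (fun s => T s w) t (opp (A (T t w))).
Proof.
  intros Ht Dw; apply is_derive_eps; intros r Hr.
  rewrite (proj2 (sg_dom t w (Rlt_le _ _ Ht) Dw)).
  destruct (sg_bound (t + 1)) as [C [HC BC]].
  destruct (sg_quotient w (r / 2 / (C + 1)) Dw) as [d1 [Hd1 Q]].
  { repeat apply Rdiv_lt_0_compat; lra. }
  destruct (sg_uniform_cont (t + 1) (A w) (r / 2)) as [d2 [Hd2 UC]]; [lra |].
  set (d := Rmin (Rmin d1 d2) (Rmin t 1)).
  assert (G1 : d <= d1) by (unfold d; eapply Rle_trans; [apply Rmin_l | apply Rmin_l]).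
  assert (G2 : d <= d2) by (unfold d; eapply Rle_trans; [apply Rmin_l | apply Rmin_r]).
  assert (G3 : d <= t) by (unfold d; eapply Rle_trans; [apply Rmin_r | apply Rmin_l]).
  assert (G4 : d <= 1) by (unfold d; eapply Rle_trans; [apply Rmin_r | apply Rmin_r]).
  assert (Hd : 0 < d) by (unfold d; repeat apply Rmin_glb_lt; lra).
  exists d; split; [exact Hd |]; intros s Hs.
  assert (est : forall s0 k, 0 <= s0 <= t + 1 -> 0 <= k < d1 ->
      norm (T s0 (plus (minus (T k w) w) (scal k (A w)))) <= r / 2 * k).
  { intros s0 k Hs0 Hk; eapply Rle_trans; [now apply BC |].
    apply Rle_trans with ((C + 1) * (r / 2 / (C + 1) * k)); [| right; field; lra].
    apply Rmult_le_compat; [exact HC | apply norm_nonneg | lra | now apply Q]. }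
  pose proof Hs as Hs'; apply Rabs_def2 in Hs'.
  destruct (Rle_dec t s) as [L | L].
  - rewrite (Rabs_pos_eq (s - t)) in Hs |- *; [| lra].
    rewrite (_ : minus (minus (T s w) (T t w)) (scal (s - t) (opp (T t (A w)))) =
      T t (plus (minus (T (s - t) w) w) (scal (s - t) (A w)))).
    2:{ rewrite (linear_plus _ (sg_linear _ _ _ T_exp t ltac:(lra))) sg_minus ?sg_scal; try lra.
        rewrite -(sg_plus _ _ _ T_exp); try lra.
        replace (t + (s - t)) with s by ring; vec. }
    specialize (est t (s - t) ltac:(lra) ltac:(lra)); fold_ops; nra.
  (* The generator controls quotients from the right only. For s < t the increment is expanded from
     s, at the price of comparing T s (A w) with T t (A w). *)
  - rewrite (Rabs_left (s - t)) in Hs |- *; [| lra].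
    rewrite (_ : minus (minus (T s w) (T t w)) (scal (s - t) (opp (T t (A w)))) =
      plus (opp (T s (plus (minus (T (t - s) w) w) (scal (t - s) (A w)))))
        (scal (t - s) (minus (T s (A w)) (T t (A w))))).
    2:{ rewrite (linear_plus _ (sg_linear _ _ _ T_exp s ltac:(lra))) sg_minus ?sg_scal; try lra.
        rewrite -(sg_plus _ _ _ T_exp); try lra.
        replace (s + (t - s)) with t by ring; vec. }
    eapply Rle_trans; [apply norm_plus_le |].
    rewrite norm_opp norm_scal_eq (Rabs_pos_eq (t - s)); [| lra].
    specialize (est s (t - s) ltac:(lra) ltac:(lra)).
    assert (norm (minus (T s (A w)) (T t (A w))) <= r / 2).
    { apply UC; [lra | lra | rewrite Rabs_left; lra]. }
    assert ((t - s) * norm (minus (T s (A w)) (T t (A w))) <= (t - s) * (r / 2))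
      by (apply Rmult_le_compat_l; lra).
    fold_ops; lra.
Qed.

Context (Ann : nonnegative D A) (Lam : R) (Lam_pos : 0 < Lam).
Context {P : H -> H} (P_spec : is_spectral_projection D A Lam P).
Local Notation X := (closed_span (low_eigenvector D A Lam)).
Local Notation Q := (complement P).

Lemma compl_scal (a : R) u : Q (scal a u) = scal a (Q u).
Proof. unfold complement; rewrite (proj_scal Lam P_spec); vec. Qed.

(** On D the energy |Q T w|^2 is differentiable with derivative - 2 <A Q T w, Q T w>, so the form
    bound gives Gronwall with rate 2 m and K = 0. *)
Lemma sg_high_decay_dom (m t : R) w :
  (forall u, range Q u -> D u -> m * inner u u <= inner (A u) u) ->
  0 <= t -> D w -> norm (Q (T t w)) <= exp (- (m * t)) * norm (Q w).
Proof.
  intros form Ht Dw.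
  apply norm_le_sqr.
  { apply Rmult_le_pos; [apply Rlt_le, exp_pos | apply norm_nonneg]. }
  replace (exp (- (m * t)) * norm (Q w) * (exp (- (m * t)) * norm (Q w)))
    with (0 + exp (- (2 * m * t)) * (inner (Q (T 0 w)) (Q (T 0 w)) - 0)).
  2:{ rewrite (sg_zero _ _ _ T_exp) -norm_sqr.
      replace (- (2 * m * t)) with (- (m * t) + - (m * t)) by ring.
      rewrite exp_plus; ring. }
  apply (gronwall (fun t => inner (Q (T t w)) (Q (T t w)))); [exact Ht | |].
  - intros s Hs; eexists; split.
    + apply (is_derive_sqr (fun t => Q (T t w))).
      apply (is_derive_contraction (fun t => T t w)); [exact (fun t => T t w) | | | |].
      * apply (compl_minus Lam P_spec).
      * apply compl_scal.
      * apply (compl_norm Lam P_spec).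
      * apply sg_derive; [exact Hs | exact Dw].
    + destruct (sg_dom s w (Rlt_le _ _ Hs) Dw) as [DT _].
      replace (opp (A (T s w))) with (scal (-1) (A (T s w))) by vec.
      rewrite compl_scal (compl_op Asa Lam Lam_pos P_spec) // inner_scal_l.
      specialize (form (Q (T s w)) (compl_range _) (compl_dom Asa Lam Lam_pos P_spec _ DT)).
      lra.
  - intros r Hr.
    set (c := norm (Q w)); pose proof (norm_nonneg (Q w)) as c0; fold c in c0.
    destruct (sg_cont_eps w (Rmin 1 (r / (2 * c + 1)))) as [d [Hd HC]].
    { apply Rmin_glb_lt; [lra | apply Rdiv_lt_0_compat; lra]. }
    exists d; split; [exact Hd |]; intros s Hs; specialize (HC s Hs).
    rewrite (sg_zero _ _ _ T_exp) -!norm_sqr; fold c.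
    apply Rmin_Rgt_l in HC as [HC1 HC2].
    pose proof (compl_norm Lam P_spec (minus (T s w) w)) as G.
    rewrite (compl_minus Lam P_spec) in G.
    pose proof (norm_le_plus_minus (Q (T s w)) (Q w)) as T1.
    pose proof (norm_le_plus_minus (Q w) (Q (T s w))) as T2.
    rewrite (norm_minus_sym (Q w)) in T2; fold c in T1, T2.
    set (x := norm (Q (T s w))) in *; set (e := norm (minus (Q (T s w)) (Q w))) in *.
    assert (e0 : 0 <= e) by apply norm_nonneg.
    assert (x0 : 0 <= x) by apply norm_nonneg.
    assert (He : e * (2 * c + 1) <= r).
    { apply Rle_trans with (r / (2 * c + 1) * (2 * c + 1)); [| right; field; lra].
      apply Rmult_le_compat_r; fold_ops; lra. }
    fold_ops; clearbody x e c; apply Rabs_le; split; nra.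
Qed.

(** Both sides are continuous in w, so the estimate extends from the dense domain. *)
Lemma sg_high_decay (m t : R) w :
  (forall u, range Q u -> D u -> m * inner u u <= inner (A u) u) ->
  0 <= t -> norm (Q (T t w)) <= exp (- (m * t)) * norm (Q w).
Proof.
  intros form Ht; apply le_epsilon; intros r Hr.
  destruct (sg_bound t) as [C [HC BC]].
  pose proof (exp_pos (- (m * t))) as Ep; set (E := exp (- (m * t))) in *.
  destruct (proj1 (proj2 Asa) w (r / (C + E))) as [v [Dv Hv]].
  { apply Rdiv_lt_0_compat; lra. }
  pose proof (sg_high_decay_dom m t v form Ht Dv) as G; fold E in G.
  pose proof (norm_le_plus_minus (Q (T t w)) (Q (T t v))) as T1.
  rewrite -(compl_minus Lam P_spec) -sg_minus // in T1.
  pose proof (compl_norm Lam P_spec (T t (minus w v))) as T2.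
  pose proof (BC t (minus w v) ltac:(lra)) as T3.
  pose proof (norm_le_plus_minus (Q v) (Q w)) as T4.
  rewrite -(compl_minus Lam P_spec) in T4.
  pose proof (compl_norm Lam P_spec (minus v w)) as T5.
  rewrite (norm_minus_sym v w) in T5.
  assert (T6 : norm (minus w v) * (C + E) <= r).
  { apply Rle_trans with (r / (C + E) * (C + E)); [| right; field; lra].
    apply Rmult_le_compat_r; lra. }
  assert (T7 : E * norm (Q v) <= E * (norm (Q w) + norm (minus w v))).
  { apply Rmult_le_compat_l; fold_ops; lra. }
  fold_ops; lra.
Qed.

Lemma sg_low_mode (lam t : R) e u : D e -> A e = scal lam e -> 0 <= t ->
  inner (T t u) e = exp (- (lam * t)) * inner u e.
Proof.
  intros De Ae Ht.
  (* The pairing y = <T t w, e> solves y' = - lam y. Gronwall bounds only from above; a = 1 and a =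
     -1 together give equality. *)
  assert (half : forall (a : R) w, D w ->
      a * inner (T t w) e <= exp (- (lam * t)) * (a * inner w e)).
  { intros a w Dw.
    replace (exp (- (lam * t)) * (a * inner w e)) with
      (0 + exp (- (lam * t)) * (inner (T 0 w) (scal a e) - 0))
      by (rewrite (sg_zero _ _ _ T_exp) inner_scal_r; ring).
    rewrite -inner_scal_r.
    apply (gronwall (fun t => inner (T t w) (scal a e))); [exact Ht | |].
    - intros s Hs; exists (inner (opp (A (T s w))) (scal a e)); split.
      + apply (is_derive_inner (fun t => T t w)), sg_derive; [exact Hs | exact Dw].
      + destruct (sg_dom s w (Rlt_le _ _ Hs) Dw) as [DT _].
        rewrite inner_opp_l !inner_scal_r (sa_symmetric Asa) // Ae inner_scal_r.
        right; ring.
    - intros r Hr; pose proof (norm_nonneg (scal a e)).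
      destruct (sg_cont_eps w (r / (norm (scal a e) + 1))) as [d [Hd HC]].
      { apply Rdiv_lt_0_compat; lra. }
      exists d; split; [exact Hd |]; intros s Hs; specialize (HC s Hs).
      rewrite (sg_zero _ _ _ T_exp) -inner_minus_l.
      eapply Rle_trans; [apply cauchy_schwarz_abs |].
      apply Rle_trans with (r / (norm (scal a e) + 1) * (norm (scal a e) + 1));
        [| right; field; lra].
      apply Rmult_le_compat; try apply norm_nonneg; lra. }
  assert (onD : forall w, D w -> inner (T t w) e = exp (- (lam * t)) * inner w e).
  { intros w Dw; pose proof (half 1 w Dw); pose proof (half (-1) w Dw); lra. }
  destruct (sg_bound t) as [C [HC BC]].
  destruct (functional_choice_R (fun (n : nat) v => D v /\ norm (minus u v) < / (INR n + 1)))
    as [x Hx].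
  { intro n; apply (proj1 (proj2 Asa)), Rinv_0_lt_compat; pose proof (pos_INR n); lra. }
  assert (Tx : tends x u).
  { intros r Hr; destruct (inv_INR_small r Hr) as [N HN]; exists N; intros n Hn.
    specialize (HN n Hn); destruct (Hx n) as [_ G]; rewrite norm_minus_sym; lra. }
  apply (tends_R_unique (fun n => inner (T t (x n)) e)).
  - apply (tends_inner (fun n => T t (x n))).
    apply (tends_lip (T t) C); [| exact Tx].
    intros v w; rewrite -sg_minus //; apply BC; lra.
  - apply (tends_R_ext (fun n => inner (x n) (scal (exp (- (lam * t))) e))).
    + intro n; rewrite inner_scal_r onD //; apply Hx.
    + rewrite -inner_scal_r; now apply tends_inner.
Qed.

End Semigroup.

(** * Mild solutions *)

Section Orbits.
Context {H : HilbertSpace} {T : R -> H -> H} {F : H -> H} {S : R -> H -> H}.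
Context (S_mild : is_mild_semiflow T F S).

Lemma mild_zero u : T 0 u = u -> S 0 u = u.
Proof.
  intro T0; destruct (S_mild u) as [_ I]; specialize (I 0 (Rle_refl 0)).
  pose proof (is_RInt_point (fun s => T (0 - s) (F (S s u))) 0) as J.
  apply is_RInt_unique in I; apply is_RInt_unique in J.
  rewrite I T0 in J; now apply eq_of_minus_zero.
Qed.

(* [S (Rmax 0 t) u] extends the orbit continuously to negative times. *)
Lemma mild_continuous u t : continuous (fun s => S (Rmax 0 s) u) t.
Proof.
  apply continuous_eps; intros r Hr.
  destruct (S_mild u) as [C _]; specialize (C (Rmax 0 t) (Rmax_l 0 t)).
  apply (filterlim_eps (within (fun s => 0 <= s) (locally (Rmax 0 t)))) with (r := r) in C;
    [| exact Hr].
  apply locally_R in C; destruct C as [d [Hd HC]]; exists d; split; [exact Hd |].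
  intros s Hs; apply HC; [| apply Rmax_l].
  apply Rle_lt_trans with (2 := Hs).
  unfold Rmax; destruct (Rle_dec 0 s), (Rle_dec 0 t); unfold Rabs;
    repeat destruct Rcase_abs; lra.
Qed.

Lemma mild_near_zero u r : T 0 u = u -> 0 < r -> exists d, 0 < d /\
  forall t, 0 <= t < d -> norm (minus (S t u) u) < r.
Proof.
  intros T0 Hr.
  destruct (proj1 (continuous_eps _ _) (mild_continuous u 0) r Hr) as [d [Hd HC]].
  exists d; split; [exact Hd |]; intros t Ht.
  specialize (HC t); rewrite Rmax_right in HC; [| lra].
  rewrite Rmax_left in HC; [| lra].
  rewrite mild_zero // in HC; apply HC; rewrite Rminus_0_r Rabs_pos_eq; lra.
Qed.

End Orbits.

(** * High and low components of mild solutions *)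

Section Mild.
Context {H : HilbertSpace} {D : H -> Prop} {A : H -> H} {T : R -> H -> H}.
Context (Asa : self_adjoint D A) (T_exp : is_exp_semigroup D A T).
Context {F : H -> H} {M L : R}.
Context (F_bound : forall u, norm (F u) <= M).
Context (F_lip : forall u w, norm (minus (F u) (F w)) <= L * norm (minus u w)).
Context {S : R -> H -> H} (S_mild : is_mild_semiflow T F S).
Context (Lam : R) (Lam_pos : 0 < Lam).
Context {P : H -> H} (P_spec : is_spectral_projection D A Lam P).
Local Notation X := (closed_span (low_eigenvector D A Lam)).
Local Notation Q := (complement P).

Lemma proj_is_linear : is_linear P.
Proof.
  split; [apply (proj_plus Lam P_spec) | apply (proj_scal Lam P_spec) |].
  exists 1; split; [lra |]; intro u; rewrite Rmult_1_l; apply (proj_norm Lam P_spec).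
Qed.

Lemma compl_is_linear : is_linear Q.
Proof.
  split.
  - intros u v; unfold complement; rewrite (proj_plus Lam P_spec); vec.
  - intros a u; apply (compl_scal Lam P_spec).
  - exists 1; split; [lra |]; intro u; rewrite Rmult_1_l; apply (compl_norm Lam P_spec).
Qed.

(** The right-hand side is a convex combination of |Q u| and M / m, so the level M / m is preserved
    and is approached exponentially. *)
Lemma mild_high_bound (m t : R) u :
  0 < m -> (forall u, range Q u -> D u -> m * inner u u <= inner (A u) u) -> 0 <= t ->
  norm (Q (S t u)) <= exp (- (m * t)) * norm (Q u) + M / m * (1 - exp (- (m * t))).
Proof.
  intros Hm form Ht.
  destruct (S_mild u) as [_ I]; specialize (I t Ht).
  apply (is_RInt_linear Q _ _ _ _ compl_is_linear) in I.
  assert (J : is_RInt (fun s => M * exp (- (m * (t - s)))) 0 t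
    (minus (M / m * exp (- (m * (t - t)))) (M / m * exp (- (m * (t - 0)))))).
  { apply (is_RInt_derive (fun s => M / m * exp (- (m * (t - s))))).
    - intros x _; auto_derive; [auto |]; unfold Rminus; field; lra.
    - intros x _; apply (ex_derive_continuous (V := R_NormedModule)).
      auto_derive; auto. }
  assert (N : norm (Q (minus (S t u) (T t u))) <=
    minus (M / m * exp (- (m * (t - t)))) (M / m * exp (- (m * (t - 0))))).
  { refine (norm_RInt_le _ _ 0 t _ _ Ht _ I J).
    intros s Hs.
    eapply Rle_trans; [apply (sg_high_decay Asa T_exp Lam Lam_pos P_spec m); [exact form | lra] |].
    rewrite Rmult_comm; apply Rmult_le_compat_r; [apply Rlt_le, exp_pos |].
    eapply Rle_trans; [apply (compl_norm Lam P_spec) | apply F_bound]. }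
  rewrite Rminus_diag Rminus_0_r Rmult_0_r Ropp_0 exp_0 in N.
  change (minus (M / m * 1) (M / m * exp (- (m * t))))
    with (M / m * 1 - M / m * exp (- (m * t))) in N.
  rewrite (compl_minus Lam P_spec) in N.
  pose proof (sg_high_decay Asa T_exp Lam Lam_pos P_spec m t u form Ht).
  pose proof (norm_le_plus_minus (Q (S t u)) (Q (T t u))).
  fold_ops; lra.
Qed.

Lemma orth_low v : (forall e, low_eigenvector D A Lam e -> inner v e = 0) ->
  forall x, X x -> inner v x = 0.
Proof.
  intros E x Xx; destruct (closed_span_seq _ _ Xx) as [y [Sy Ty]].
  rewrite inner_sym; apply (tends_R_unique (fun n => inner (y n) v)).
  - now apply tends_inner.
  - intros r Hr; exists 0%nat; intros n _.
    assert (Z : inner (y n) v = 0); [| rewrite Z Rminus_0_r Rabs_R0; lra].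
    refine (span_ind _ (fun w => inner w v = 0) _ _ _ (Sy n)).
    + intros a e He; rewrite inner_scal_l inner_sym E //; ring.
    + intros w a e IH He; rewrite inner_plus_l IH inner_scal_l (inner_sym _ e) E //; ring.
Qed.

Lemma mild_forcing_continuous e u s :
  continuous (fun s => inner (F (S (Rmax 0 s) u)) e) s.
Proof.
  apply continuity_pt_filterlim; intros r Hr.
  pose proof (norm_nonneg e); pose proof (Rabs_pos L).
  assert (G : 0 < r / ((Rabs L + 1) * (norm e + 1))).
  { apply Rdiv_lt_0_compat; [exact Hr | apply Rmult_lt_0_compat; lra]. }
  destruct (proj1 (continuous_eps _ _) (mild_continuous S_mild u s) _ G) as [d [Hd HC]].
  exists d; split; [exact Hd |]; intros x [_ Hx]; simpl in Hx |- *.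
  unfold R_dist in *; specialize (HC x Hx).
  rewrite -inner_minus_l.
  eapply Rle_lt_trans; [apply cauchy_schwarz_abs |].
  set (z := norm (minus (S (Rmax 0 x) u) (S (Rmax 0 s) u))) in *.
  assert (z0 : 0 <= z) by apply norm_nonneg.
  assert (B : norm (minus (F (S (Rmax 0 x) u)) (F (S (Rmax 0 s) u))) <= (Rabs L + 1) * z).
  { eapply Rle_trans; [apply F_lip |]; fold z; pose proof (Rle_abs L).
    apply Rmult_le_compat_r; lra. }
  apply Rle_lt_trans with ((Rabs L + 1) * z * (norm e + 1)).
  { apply Rmult_le_compat; try apply norm_nonneg; lra. }
  apply Rlt_le_trans with
    ((Rabs L + 1) * (r / ((Rabs L + 1) * (norm e + 1))) * (norm e + 1));
    [| right; field; lra].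
  apply Rmult_lt_compat_r; [lra |]; apply Rmult_lt_compat_l; [lra | exact HC].
Qed.

(** [C] is the variation of constants formula for the scalar equation. The extended forcing makes it
    differentiable on the whole line, so that the fundamental theorem applies up to the end point
    0. *)
Lemma mild_low_mode (lam : R) e u :
  D e -> A e = scal lam e -> exists C : R -> R,
    (forall t, is_derive C t (inner (F (S (Rmax 0 t) u)) e - lam * C t)) /\
    (forall t, 0 <= t -> C t = inner (S t u) e).
Proof.
  intros De Ae.
  set (g := fun s => inner (F (S (Rmax 0 s) u)) e).
  assert (Cg : forall s, continuous g s) by (intro s; apply mild_forcing_continuous).
  assert (Cw : forall s, continuous (fun s => exp (lam * s) * g s) s).
  { intro s; apply (continuous_mult (fun s => exp (lam * s)) g); [| apply Cg].
    apply (ex_derive_continuous (V := R_NormedModule)); auto_derive; auto. }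
  assert (Iw : forall t, ex_RInt (fun s => exp (lam * s) * g s) 0 t).
  { intro t; apply (ex_RInt_continuous (V := R_CompleteNormedModule)); intros z _; apply Cw. }
  exists (fun t => exp (- (lam * t)) * (inner u e + RInt (fun s => exp (lam * s) * g s) 0 t)).
  split.
  - intro t; fold (g t).
    assert (DI : is_derive (fun t => RInt (fun s => exp (lam * s) * g s) 0 t) t
      (exp (lam * t) * g t)).
    { apply (is_derive_RInt (V := R_NormedModule) (fun s => exp (lam * s) * g s) _ 0); [| apply Cw].
      apply filter_forall; intro x; apply (RInt_correct (V := R_CompleteNormedModule)), Iw. }
    set (W := fun t => RInt (fun s => exp (lam * s) * g s) 0 t) in *.
    change (is_derive (fun t => exp (- (lam * t)) * (inner u e + W t)) t
      (g t - lam * (exp (- (lam * t)) * (inner u e + W t)))).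
    auto_derive; [now exists (exp (lam * t) * g t) |].
    rewrite (is_derive_unique _ _ _ DI).
    assert (E : exp (- (lam * t)) * exp (lam * t) = 1).
    { rewrite -exp_plus; replace (- (lam * t) + lam * t) with 0 by ring; apply exp_0. }
    transitivity (exp (- (lam * t)) * exp (lam * t) * g t
      - lam * (exp (- (lam * t)) * (inner u e + W t))); [ring | rewrite E; ring].
  - intros t Ht.
    destruct (S_mild u) as [_ I]; specialize (I t Ht); apply (is_RInt_inner e) in I.
    rewrite inner_minus_l (sg_low_mode Asa T_exp lam t e u De Ae Ht) in I.
    assert (J : is_RInt (fun s => inner (T (t - s) (F (S s u))) e) 0 t
      (exp (- (lam * t)) * RInt (fun s => exp (lam * s) * g s) 0 t)).
    { apply (is_RInt_ext (V := R_NormedModule))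
        with (fun s => exp (- (lam * t)) * (exp (lam * s) * g s)).
      - intros s; rewrite Rmin_left // Rmax_right //; intros [S1 S2].
        rewrite (sg_low_mode Asa T_exp lam (t - s) e _ De Ae); [| lra].
        unfold g; rewrite Rmax_right; [| lra].
        rewrite -Rmult_assoc -exp_plus; f_equal; f_equal; ring.
      - apply (is_RInt_scal (V := R_NormedModule)).
        apply (RInt_correct (V := R_CompleteNormedModule)), Iw. }
    apply (is_RInt_unique (V := R_CompleteNormedModule)) in I.
    apply (is_RInt_unique (V := R_CompleteNormedModule)) in J.
    rewrite J in I; lra.
Qed.

(* The integral form of the equation holds after pairing with each low eigenvector,
   hence in the range of P, where A is bounded. *)
Lemma mild_low_derive u t : 0 < t ->
  is_derive (fun s => P (S s u)) t (minus (P (F (S t u))) (A (P (S t u)))).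
Proof.
  intro Ht.
  (* [V] is the expected derivative. It is continuous because A is bounded on the range of P, so its
     primitive is differentiable. *)
  set (V := fun s => minus (P (F (S (Rmax 0 s) u))) (A (P (S (Rmax 0 s) u)))).
  assert (XV : forall s, X (V s)).
  { intro s; apply closed_span_minus; [apply (proj_in Lam P_spec) |].
    apply (low_closure Asa Lam Lam_pos), (proj_in Lam P_spec). }
  assert (CV : forall s, continuous V s).
  { intro s; apply continuous_eps; intros r Hr.
    pose proof (Rabs_pos L).
    assert (G : 0 < r / (Rabs L + Lam)) by (apply Rdiv_lt_0_compat; lra).
    destruct (proj1 (continuous_eps _ _) (mild_continuous S_mild u s) _ G) as [d [Hd HC]].
    exists d; split; [exact Hd |]; intros x Hx; specialize (HC x Hx).
    set (a := S (Rmax 0 x) u) in *; set (b := S (Rmax 0 s) u) in *.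
    rewrite (_ : minus (V x) (V s) = minus (P (minus (F a) (F b))) (A (P (minus a b)))).
    2:{ rewrite !(proj_minus Lam P_spec) (op_minus Asa);
          try apply (proj_dom Asa Lam Lam_pos P_spec).
        unfold V; fold a b; vec. }
    eapply Rle_lt_trans; [apply norm_minus_le |].
    pose proof (proj_norm Lam P_spec (minus (F a) (F b))) as T1.
    pose proof (F_lip a b) as T2.
    destruct (low_closure Asa Lam Lam_pos _ (proj_in Lam P_spec (minus a b))) as [_ [T3 _]].
    pose proof (proj_norm Lam P_spec (minus a b)) as T4.
    apply (Rmult_le_compat_l Lam) in T4; [| lra].
    pose proof (norm_nonneg (minus a b)); pose proof (Rle_abs L) as T5.
    apply (Rmult_le_compat_r (norm (minus a b))) in T5; [| assumption].
    apply (Rmult_lt_compat_l (Rabs L + Lam)) in HC; [| lra].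
    replace ((Rabs L + Lam) * (r / (Rabs L + Lam))) with r in HC by (field; lra).
    fold_ops; lra. }
  assert (IV : forall s, is_RInt V 0 s (RInt V 0 s)).
  { intro s; apply RInt_correct, ex_RInt_continuous; intros; apply CV. }
  assert (XI : forall s, X (RInt V 0 s)).
  { intro s; rewrite (_ : RInt V 0 s = P (RInt V 0 s)); [apply (proj_in Lam P_spec) |].
    apply (is_RInt_unique V), (is_RInt_ext (fun s => P (V s))).
    - intros x _; apply (proj_id Lam P_spec), XV.
    - apply is_RInt_linear; [apply proj_is_linear | apply IV]. }
  assert (EY : forall s, 0 <= s -> plus (P u) (RInt V 0 s) = P (S s u)).
  { intros s Hs; symmetry; apply (proj_unique Lam P_spec).
    { apply closed_span_plus; [apply (proj_in Lam P_spec) | apply XI]. }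
    apply orth_low; intros e He; pose proof He as [De [lam [_ Ae]]].
    assert (Pe : P e = e).
    { apply (proj_id Lam P_spec), closed_span_incl.
      rewrite (_ : e = scal 1 e); [now apply span_single | vec]. }
    destruct (mild_low_mode lam e u De Ae) as [C [DC EC]].
    pose proof (is_RInt_inner e _ _ _ _ (IV s)) as I1.
    assert (I2 : is_RInt (fun x => inner (V x) e) 0 s (minus (C s) (C 0))).
    { apply (is_RInt_ext (V := R_NormedModule))
        with (fun x => inner (F (S (Rmax 0 x) u)) e - lam * C x).
      - intros x; rewrite Rmin_left // Rmax_right //; intros [X1 X2].
        unfold V; rewrite inner_minus_l (proj_symmetric Lam P_spec) Pe; f_equal.
        rewrite EC; [| lra].
        rewrite (sa_symmetric Asa) //; [| apply (proj_dom Asa Lam Lam_pos P_spec)].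
        rewrite Ae inner_scal_r (proj_symmetric Lam P_spec) Pe Rmax_right; lra.
      - apply (is_RInt_derive (V := R_CompleteNormedModule)); intros x _; [apply DC |].
        apply (continuous_minus (V := R_NormedModule)).
        + apply mild_forcing_continuous.
        + apply (continuous_mult (fun _ => lam) C); [apply continuous_const |].
          apply (ex_derive_continuous (V := R_NormedModule)); eexists; apply DC. }
    apply (is_RInt_unique (V := R_CompleteNormedModule)) in I1.
    apply (is_RInt_unique (V := R_CompleteNormedModule)) in I2.
    rewrite I1 in I2; change (minus (C s) (C 0)) with (C s - C 0) in I2.
    rewrite !EC // in I2; [| lra].
    rewrite (mild_zero S_mild) in I2; [| apply (sg_zero _ _ _ T_exp)].
    inner_expand; rewrite I2 (proj_symmetric Lam P_spec) Pe; ring. }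
  apply is_derive_ext_loc with (fun s => plus (P u) (RInt V 0 s)).
  - apply locally_R; exists t; split; [exact Ht |]; intros s Hs.
    apply Rabs_def2 in Hs; apply EY; lra.
  - rewrite (_ : minus (P (F (S t u))) (A (P (S t u))) = plus zero (V t)).
    2:{ unfold V; rewrite Rmax_right; [vec | lra]. }
    apply (is_derive_plus (fun _ => P u) (fun s => RInt V 0 s)).
    + exact (@is_derive_const R_AbsRing H (P u) t).
    + apply (is_derive_RInt V _ 0); [| apply CV].
      apply filter_forall; intro; apply IV.
Qed.

End Mild.

(** * Attractors *)

Section Hausdorff.
Context {H : HilbertSpace}.
Implicit Types (B C : H -> Prop) (b : H).

(** Nonemptiness keeps the infimum finite, so [real] does not replace it by 0. *)
Lemma distance_spec b C : (exists c, C c) ->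
  let g := real (Glb_Rbar (fun s => exists c, C c /\ s = norm (minus b c))) in
  (forall c, C c -> g <= norm (minus b c)) /\
  (forall x, (forall c, C c -> x <= norm (minus b c)) -> x <= g).
Proof.
  intros [c0 Cc0]; simpl.
  destruct (Glb_Rbar_correct (fun s => exists c, C c /\ s = norm (minus b c))) as [Lo Gr].
  assert (G0 : Rbar_le 0 (Glb_Rbar (fun s => exists c, C c /\ s = norm (minus b c)))).
  { apply Gr; intros s [c [_ ->]]; apply norm_nonneg. }
  assert (G1 := Lo _ (ex_intro _ c0 (conj Cc0 eq_refl))).
  destruct (Glb_Rbar (fun s => exists c, C c /\ s = norm (minus b c))) as [g | |];
    simpl in G0, G1 |- *; try tauto.
  split.
  - intros c Cc; exact (Lo _ (ex_intro _ c (conj Cc eq_refl))).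
  - intros x Hx; apply (Gr (Finite x)); intros s [c [Cc ->]]; simpl; auto.
Qed.

Lemma semidist_le B C (x : R) : (exists c, C c) ->
  (forall b, B b -> forall r, 0 < r -> exists c, C c /\ norm (minus b c) <= x + r) ->
  Rbar_le (semidist B C) x.
Proof.
  intros NC E; unfold semidist.
  apply (proj2 (Lub_Rbar_correct _)); intros s [b [Bb ->]]; simpl.
  apply le_epsilon; intros r Hr; destruct (E b Bb r Hr) as [c [Cc Hc]].
  destruct (distance_spec b C NC) as [G _].
  exact (Rle_trans _ _ _ (G c Cc) Hc).
Qed.

Lemma semidist_lt B C (r : R) : (exists c, C c) -> Rbar_lt (semidist B C) r ->
  forall b, B b -> exists c, C c /\ norm (minus b c) < r.
Proof.
  intros NC Hlt b Bb; apply NNPP; intro N.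
  assert (G : Rbar_le r (semidist B C)).
  { eapply Rbar_le_trans; [| apply (proj1 (Lub_Rbar_correct _)); exists b; split;
      [exact Bb | reflexivity]].
    destruct (distance_spec b C NC) as [_ G].
    apply G; intros c Cc; apply Rnot_lt_le; intro; apply N; eauto. }
  apply (Rbar_le_not_lt _ _ G Hlt).
Qed.

Lemma hausdorff_le B C (x : Rbar) :
  Rbar_le (semidist B C) x -> Rbar_le (semidist C B) x -> Rbar_le (hausdorff B C) x.
Proof. intros; unfold hausdorff; destruct Rbar_le_dec; assumption. Qed.

End Hausdorff.

Lemma exp_decay (m c r : R) : 0 < m -> 0 <= c -> 0 < r ->
  exists t, 0 <= t /\ exp (- (m * t)) * c <= r.
Proof.
  (* With exp x >= 1 + x at x = m t = c / r, one gets r exp (m t) >= r + c. *)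
  intros Hm Hc Hr; exists (c / (m * r)).
  assert (mr : 0 < m * r) by now apply Rmult_lt_0_compat.
  split.
  { apply Rmult_le_pos; [exact Hc | apply Rlt_le, Rinv_0_lt_compat, mr]. }
  rewrite exp_Ropp; pose proof (exp_ineq1_le (m * (c / (m * r)))) as G.
  replace (m * (c / (m * r))) with (c / r) in G |- * by (field; lra).
  pose proof (exp_pos (c / r)).
  apply Rmult_le_reg_l with (exp (c / r)); [assumption |].
  rewrite -Rmult_assoc Rinv_r; [| lra].
  apply Rle_trans with ((1 + c / r) * r); [| apply Rmult_le_compat_r; lra].
  replace ((1 + c / r) * r) with (r + c) by (field; lra); lra.
Qed.

(** * Comparison of the two semiflows at a fixed eps *)

Section Comparison.
Context {H : HilbertSpace} (Hinf : infinite_dimensional H).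
Context {D : H -> Prop} {A : H -> H}.
Context (Asa : self_adjoint D A) (Ann : nonnegative D A) (Acr : compact_resolvent D A).
Context {F : H -> H} {M L : R} (M_pos : 0 < M) (L_pos : 0 < L).
Context (F_bound : forall u, norm (F u) <= M).
Context (F_lip : forall u w, norm (minus (F u) (F w)) <= L * norm (minus u w)).
Context {mu eps : R} (mu_pos : 0 < mu) (eps_pos : 0 < eps).
Context {P : H -> H} (P_spec : is_spectral_projection D A (mu / eps ^ 2) P).
Context {T Teps : R -> H -> H} (T_exp : is_exp_semigroup D A T).
Context (Teps_exp : is_exp_semigroup D (damped A P eps) Teps).
Context {S Seps : R -> H -> H} (S_mild : is_mild_semiflow T F S).
Context (Seps_mild : is_mild_semiflow Teps F Seps).
Context (gap : 8 * L <= gamma D A P eps).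
Context {h : H -> H} (h_im : is_inertial_manifold D A F M L eps P Seps h).
Context {Att Atteps : H -> Prop}.
Context (Att_S : is_global_attractor S Att) (Atteps_S : is_global_attractor Seps Atteps).

Local Notation Q := (complement P).
Local Notation lam := (lambda_plus D A P).
Local Notation al := (alpha D A P eps).
Local Notation d := (defect D A P M eps).
Local Notation Rm := (to_manifold P h).

Lemma cutoff_pos : 0 < mu / eps ^ 2.
Proof. apply Rdiv_lt_0_compat; [exact mu_pos | now apply pow_lt]. Qed.

Lemma lam_large : mu / eps ^ 2 < lam.
Proof. apply (lambda_plus_spec Hinf Asa Ann Acr _ cutoff_pos P_spec). Qed.

Lemma lam_form u : range Q u -> D u -> lam * inner u u <= inner (A u) u.
Proof. apply (lambda_plus_spec Hinf Asa Ann Acr _ cutoff_pos P_spec). Qed.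

Lemma lam_pos : 0 < lam.
Proof. pose proof lam_large; pose proof cutoff_pos; lra. Qed.

Lemma al_pos : lam < al.
Proof. unfold alpha; pose proof (Rinv_0_lt_compat eps eps_pos); lra. Qed.

Lemma M_over_al : M / al <= M / lam.
Proof.
  pose proof lam_pos; pose proof al_pos.
  apply Rmult_le_compat_l; [lra |]; apply Rinv_le_contravar; lra.
Qed.

Lemma defect_le : d <= 2 * M / mu * eps ^ 2.
Proof.
  pose proof M_over_al as G; pose proof lam_large as G2; pose proof cutoff_pos as G3.
  assert (M / lam <= M / mu * eps ^ 2).
  { replace (M / mu * eps ^ 2) with (M / (mu / eps ^ 2)) by (field; split; apply Rgt_not_eq; auto).
    apply Rmult_le_compat_l; [lra |]; apply Rinv_le_contravar; lra. }
  unfold defect; lra.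
Qed.

Lemma proj_manifold u : P (Rm u) = P u.
Proof.
  unfold to_manifold.
  rewrite (proj_plus _ P_spec) (proj_id _ P_spec (P u)); [| apply (proj_in _ P_spec)].
  rewrite (proj1 (range_compl (D := D) (A := A) _ P_spec (h (P u)))); [vec |].
  apply (im_range _ _ _ _ _ _ _ _ _ h_im); now exists u.
Qed.

Lemma manifold_graph u : graph P h (Rm u).
Proof. exists (P u); split; [now exists u | reflexivity]. Qed.

Lemma manifold_id u : graph P h u -> Rm u = u.
Proof.
  intros [p [[v Ep] Eu]].
  assert (G : u = Rm v) by (rewrite Eu Ep; reflexivity).
  unfold to_manifold at 1; rewrite G proj_manifold; reflexivity.
Qed.

Lemma manifold_defect u : norm (Q u) <= M / lam -> norm (minus (Rm u) u) <= d.
Proof.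
  intro Hu.
  rewrite (_ : minus (Rm u) u = minus (h (P u)) (Q u)).
  2:{ unfold to_manifold, complement; vec. }
  eapply Rle_trans; [apply norm_minus_le |].
  pose proof (im_bound _ _ _ _ _ _ _ _ _ h_im (P u) (ex_intro _ u eq_refl)).
  unfold defect; fold_ops; lra.
Qed.

(** [eta] ranges over both attractors; this supplies on that of S_eps the high-mode bound from which
    orbits of S may start. *)
Lemma graph_high u : graph P h u -> norm (Q u) <= M / lam.
Proof.
  intro G; rewrite -(manifold_id u G).
  rewrite (_ : Q (Rm u) = h (P u)).
  2:{ unfold complement; rewrite proj_manifold; unfold to_manifold; vec. }
  eapply Rle_trans; [| apply M_over_al].
  apply (im_bound _ _ _ _ _ _ _ _ _ h_im); now exists u.
Qed.

(** The gap gives Lip(h) <= 4 L / gamma <= 1/2, and 3/2 = 1 + 1/2. *)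
Lemma manifold_lip u v : norm (minus (Rm u) (Rm v)) <= 3 / 2 * norm (minus (P u) (P v)).
Proof.
  rewrite (_ : minus (Rm u) (Rm v) =
    plus (minus (P u) (P v)) (minus (h (P u)) (h (P v)))).
  2:{ unfold to_manifold; vec. }
  eapply Rle_trans; [apply norm_plus_le |].
  pose proof (im_lip _ _ _ _ _ _ _ _ _ h_im (P u) (P v)
    (ex_intro _ u eq_refl) (ex_intro _ v eq_refl)) as G.
  assert (4 * L / gamma D A P eps <= / 2).
  { apply Rmult_le_reg_r with (gamma D A P eps); [lra |].
    unfold Rdiv; rewrite Rmult_assoc Rinv_l; lra. }
  pose proof (norm_nonneg (minus (P u) (P v))).
  fold_ops; nra.
Qed.

Lemma orbit_high u t : 0 <= t -> norm (Q u) <= M / lam -> norm (Q (S t u)) <= M / lam.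
Proof.
  intros Ht Hu.
  pose proof (mild_high_bound Asa T_exp F_bound S_mild _ cutoff_pos P_spec lam t u
    lam_pos lam_form Ht) as G.
  pose proof (exp_pos (- (lam * t))).
  assert (exp (- (lam * t)) * norm (Q u) <= exp (- (lam * t)) * (M / lam)).
  { apply Rmult_le_compat_l; lra. }
  lra.
Qed.

(** By invariance u has a preimage in the bounded attractor at every earlier time, so the
    contribution of the initial value can be made arbitrarily small. *)
Lemma attractor_high u : Att u -> norm (Q u) <= M / lam.
Proof.
  intro Hu; apply le_epsilon; intros r Hr.
  destruct (compact_bounded Att (att_compact _ _ Att_S)) as [c [Hc Bc]].
  destruct (exp_decay lam c r lam_pos (Rlt_le _ _ Hc) Hr) as [t [Ht He]].
  destruct (proj2 (att_invariant _ _ Att_S t Ht u) Hu) as [w [Hw ->]].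
  pose proof (mild_high_bound Asa T_exp F_bound S_mild _ cutoff_pos P_spec lam t w
    lam_pos lam_form Ht) as G.
  pose proof (exp_pos (- (lam * t))).
  assert (exp (- (lam * t)) * norm (Q w) <= exp (- (lam * t)) * c).
  { apply Rmult_le_compat_l; [lra |].
    eapply Rle_trans; [apply (compl_norm _ P_spec) | auto]. }
  assert (0 < M / lam) by (apply Rdiv_lt_0_compat; [exact M_pos | apply lam_pos]).
  nra.
Qed.

Lemma attractors_hausdorff (E : R) :
  (forall u t, Att u \/ Atteps u -> 0 <= t ->
     norm (minus (Rm (S t u)) (Seps t (Rm u))) <= E) ->
  Rbar_le (hausdorff Atteps Att) (E + d).
Proof.
  intro HE; apply hausdorff_le; apply semidist_le.
  - apply (att_nonempty _ _ Att_S).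
  - intros b Hb r Hr.
    destruct (compact_bounded Atteps (att_compact _ _ Atteps_S)) as [c [_ Bc]].
    (* The distance from S t w to a is later multiplied by the Lipschitz constant 3/2 of R, and 3/2
       times r / 2 stays below r. The defect d is paid at the point a of the attractor of S. *)
    destruct (att_attracts _ _ Att_S Atteps (ex_intro _ c Bc) (r / 2)) as [t0 Ht0]; [lra |].
    specialize (Ht0 (Rmax t0 0) (Rmax_l _ _) (Rmax_r _ _)).
    set (t := Rmax t0 0) in *; assert (Ht : 0 <= t) by apply Rmax_r.
    destruct (proj2 (att_invariant _ _ Atteps_S t Ht b) Hb) as [w [Hw ->]].
    destruct (semidist_lt _ _ _ (att_nonempty _ _ Att_S) Ht0 (S t w)) as [a [Ha Ga]].
    { now exists w. }
    exists a; split; [exact Ha |].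
    pose proof (HE w t (or_intror Hw) Ht) as G1.
    rewrite (manifold_id w) in G1; [| apply (im_attractor _ _ _ _ _ _ _ _ _ h_im _ Atteps_S _ Hw)].
    rewrite norm_minus_sym in G1.
    pose proof (manifold_lip (S t w) a) as G2.
    pose proof (manifold_defect a (attractor_high a Ha)) as G3.
    pose proof (proj_norm _ P_spec (minus (S t w) a)) as G4.
    rewrite (proj_minus _ P_spec) in G4.
    pose proof (norm_minus_triangle (Seps t w) (Rm (S t w)) a) as T1.
    pose proof (norm_minus_triangle (Rm (S t w)) (Rm a) a) as T2.
    fold_ops; lra.
  - apply (att_nonempty _ _ Atteps_S).
  - intros b Hb r Hr.
    destruct (compact_bounded Att (att_compact _ _ Att_S)) as [c [_ Bc]].
    (* The set to be attracted is R(Att), since the comparison orbit starts at R w. *)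
    assert (BB : bounded_set (image Rm Att)).
    { exists (c + M / al); intros v [u [Hu ->]].
      eapply Rle_trans; [apply norm_plus_le |].
      pose proof (im_bound _ _ _ _ _ _ _ _ _ h_im (P u) (ex_intro _ u eq_refl)).
      pose proof (proj_norm _ P_spec u); specialize (Bc u Hu); fold_ops; lra. }
    destruct (att_attracts _ _ Atteps_S _ BB r Hr) as [t0 Ht0].
    specialize (Ht0 (Rmax t0 0) (Rmax_l _ _) (Rmax_r _ _)).
    set (t := Rmax t0 0) in *; assert (Ht : 0 <= t) by apply Rmax_r.
    destruct (proj2 (att_invariant _ _ Att_S t Ht b) Hb) as [w [Hw Eb]].
    destruct (semidist_lt _ _ _ (att_nonempty _ _ Atteps_S) Ht0 (Seps t (Rm w))) as [a [Ha Ga]].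
    { exists (Rm w); split; [now exists w | reflexivity]. }
    exists a; split; [exact Ha |].
    pose proof (HE w t (or_introl Hw) Ht) as G1; rewrite -Eb in G1.
    pose proof (manifold_defect b (attractor_high b Hb)) as G3.
    rewrite norm_minus_sym in G3.
    pose proof (norm_minus_triangle b (Rm b) a) as T1.
    pose proof (norm_minus_triangle (Rm b) (Seps t (Rm w)) a) as T2.
    fold_ops; lra.
Qed.

Lemma attractor_bounds_of_eta (C0 : R) :
  Rbar_le (eta P h S Seps Att Atteps) (C0 * eps ^ 2) ->
  Rbar_le (hausdorff Atteps Att) (Rbar_plus (eta P h S Seps Att Atteps) d) /\
  Rbar_le (Rbar_plus (eta P h S Seps Att Atteps) d) ((C0 + 2 * M / mu) * eps ^ 2).
Proof.
  intro He.
  assert (Up : forall u t, Att u \/ Atteps u -> 0 <= t ->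
    Rbar_le (norm (minus (Rm (S t u)) (Seps t (Rm u)))) (eta P h S Seps Att Atteps)).
  { intros u t Hu Ht; apply (proj1 (Lub_Rbar_correct _)); exists u, t; auto. }
  (* A point of the attractor excludes eta = m_infty; the assumed bound excludes p_infty. *)
  destruct (att_nonempty _ _ Att_S) as [u0 Hu0].
  pose proof (Up u0 0 (or_introl Hu0) (Rle_refl 0)) as U0.
  destruct (eta P h S Seps Att Atteps) as [E | |]; simpl in He, U0; try tauto.
  split.
  - apply attractors_hausdorff; intros u t Hu Ht; exact (Up u t Hu Ht).
  - simpl; pose proof defect_le; lra.
Qed.

(** Monotonicity compares two low components with a common high part, taken to be q = Q (S s u).
    Replacing q by h (p s) in the second equation leaves a forcing of size at most L (|q| + |h (p
    s)|) <= L d, uniformly in time. *)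
Lemma low_error (sigma : R) u t : 0 < sigma -> strongly_monotone A F P sigma ->
  norm (Q u) <= M / lam -> 0 <= t ->
  norm (minus (P (S t u)) (P (Seps t (Rm u)))) <= L * d / sigma.
Proof.
  intros sigma_pos mono Hu Ht.
  set (p := fun s => P (Seps s (Rm u))).
  set (z := fun s => minus (P (S s u)) (p s)).
  assert (d_pos : 0 < d).
  { unfold defect; pose proof lam_pos; pose proof al_pos.
    apply Rplus_lt_0_compat; apply Rdiv_lt_0_compat; lra. }
  assert (S0 : S 0 u = u) by (apply (mild_zero S_mild), (sg_zero _ _ _ T_exp)).
  assert (Se0 : Seps 0 (Rm u) = Rm u)
    by (apply (mild_zero Seps_mild), (sg_zero _ _ _ Teps_exp)).
  assert (z0 : z 0 = zero).
  { unfold z, p; rewrite S0 Se0 proj_manifold; vec. }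
  set (K := (L * d / sigma) * (L * d / sigma)).
  assert (K0 : 0 <= K) by apply Rle_0_sqr.
  apply norm_le_sqr; [apply Rlt_le, Rdiv_lt_0_compat; nra |].
  fold K; change (inner (z t) (z t) <= K).
  (* The rate is sigma instead of 2 sigma: half of the dissipation absorbs the forcing, which makes
     the inequality linear in |z|^2. *)
  apply Rle_trans with (K + exp (- (sigma * t)) * (inner (z 0) (z 0) - K)).
  2:{ rewrite z0 inner_zero_l; pose proof (exp_pos (- (sigma * t))); nra. }
  apply (gronwall (fun s => inner (z s) (z s))); [exact Ht | |].
  - intros s Hs.
    pose proof (mild_low_derive Asa T_exp F_lip S_mild _ cutoff_pos P_spec u s Hs) as D1.
    pose proof (im_dynamics _ _ _ _ _ _ _ _ _ h_im (Rm u) (manifold_graph u) s Hs) as D2.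
    cbv zeta in D2.
    eexists; split.
    { apply is_derive_sqr, (is_derive_minus _ _ _ _ _ D1 D2). }
    fold (p s); set (v := S s u).
    set (q := Q v).
    assert (Ev : v = plus (P v) q) by (unfold q, complement; vec).
    pose proof (mono (P v) (p s) q (ex_intro _ v eq_refl) (ex_intro _ (Seps s (Rm u)) eq_refl)
      (compl_range v)) as G; rewrite -Ev in G.
    change (minus (P v) (p s)) with (z s) in G |- *.
    set (w := minus (F (plus (p s) q)) (F (plus (p s) (h (p s))))).
    assert (EA : A (z s) = minus (A (P v)) (A (p s))).
    { unfold z; fold v; rewrite (op_minus Asa) //; apply (proj_dom Asa _ cutoff_pos P_spec). }
    rewrite (_ : minus (minus (P (F v)) (A (P v)))
        (minus (P (F (plus (p s) (h (p s))))) (A (p s))) =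
      plus (opp (minus (A (z s)) (P (minus (F v) (F (plus (p s) q)))))) (P w)).
    2:{ unfold w; rewrite EA !(proj_minus _ P_spec); vec. }
    rewrite inner_plus_l inner_opp_l.
    assert (Bw : norm (P w) <= L * d).
    { eapply Rle_trans; [apply (proj_norm _ P_spec) |].
      eapply Rle_trans; [apply F_lip |].
      apply Rmult_le_compat_l; [lra |].
      rewrite (_ : minus (plus (p s) q) (plus (p s) (h (p s))) = minus q (h (p s))); [| vec].
      eapply Rle_trans; [apply norm_minus_le |].
      pose proof (orbit_high u s (Rlt_le _ _ Hs) Hu) as B1; fold v q in B1.
      pose proof (im_bound _ _ _ _ _ _ _ _ _ h_im (p s)
        (ex_intro _ (Seps s (Rm u)) eq_refl)) as B2.
      unfold defect; fold_ops; lra. }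
    pose proof (cauchy_schwarz (P w) (z s)) as CS.
    rewrite -norm_sqr; pose proof (norm_nonneg (z s)) as Nz.
    set (x := norm (z s)) in *.
    assert (CS' : inner (P w) (z s) <= L * d * x).
    { eapply Rle_trans; [exact CS |]; apply Rmult_le_compat_r; assumption. }
    assert (G' : sigma * (x * x) <=
      inner (minus (A (z s)) (P (minus (F v) (F (plus (p s) q))))) (z s)).
    { eapply Rle_trans; [right | exact G]; simpl; ring. }
    (* AM-GM: [2 L d x <= sigma x^2 + (L d)^2 / sigma] *)
    assert (AG : 2 * (L * d * x) <= sigma * (x * x) + sigma * K).
    { pose proof (Rle_0_sqr (x - L * d / sigma)) as Y; unfold Rsqr in Y.
      apply (Rmult_le_compat_l sigma) in Y; [| lra].
      unfold K; replace (2 * (L * d * x)) with (2 * (sigma * (L * d / sigma) * x))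
        by (field; lra).
      nra. }
    fold_ops; lra.
  - intros r Hr.
    (* Two errors of this size give |z| <= min(1, r), hence |z|^2 <= r. *)
    assert (Hr1 : 0 < Rmin 1 r / 2) by (pose proof (Rmin_glb_lt 1 r 0); lra).
    destruct (mild_near_zero S_mild u _ (sg_zero _ _ _ T_exp u) Hr1) as [d1 [Hd1 C1]].
    destruct (mild_near_zero Seps_mild (Rm u) _ (sg_zero _ _ _ Teps_exp _) Hr1)
      as [d2 [Hd2 C2]].
    exists (Rmin d1 d2); split; [now apply Rmin_glb_lt |]; intros s [Hs1 Hs2].
    apply Rmin_Rgt_l in Hs2 as [Hs2 Hs3].
    specialize (C1 s (conj Hs1 Hs2)); specialize (C2 s (conj Hs1 Hs3)).
    assert (Ez : z s = minus (P (minus (S s u) u)) (P (minus (Seps s (Rm u)) (Rm u)))).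
    { rewrite !(proj_minus _ P_spec) proj_manifold; unfold z, p; vec. }
    pose proof (norm_minus_le (P (minus (S s u) u)) (P (minus (Seps s (Rm u)) (Rm u)))) as N.
    rewrite -Ez in N.
    pose proof (proj_norm _ P_spec (minus (S s u) u)).
    pose proof (proj_norm _ P_spec (minus (Seps s (Rm u)) (Rm u))).
    pose proof (norm_nonneg (z s)); pose proof (Rmin_l 1 r); pose proof (Rmin_r 1 r).
    assert (norm (z s) <= Rmin 1 r) by (fold_ops; lra).
    rewrite z0 inner_zero_l Rminus_0_r Rabs_pos_eq; [| apply inner_ge_0].
    rewrite -norm_sqr; nra.
Qed.

(** S_eps(t) R u stays on the manifold and is fixed by R, so the difference is at most 3/2 of the
    low-mode error L d / sigma; with d <= 2 M eps^2 / mu this is the stated constant. *)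
Lemma eta_le_of_strongly_monotone (sigma : R) : 0 < sigma -> strongly_monotone A F P sigma ->
  Rbar_le (eta P h S Seps Att Atteps) (3 * L * M / (sigma * mu) * eps ^ 2).
Proof.
  intros sigma_pos mono.
  apply (proj2 (Lub_Rbar_correct _)); intros r [u [t [Hu [Ht ->]]]]; simpl.
  assert (Qu : norm (Q u) <= M / lam).
  { destruct Hu as [Hu | Hu]; [now apply attractor_high |].
    apply graph_high, (im_attractor _ _ _ _ _ _ _ _ _ h_im _ Atteps_S _ Hu). }
  assert (G : graph P h (Seps t (Rm u))).
  { apply (im_invariant _ _ _ _ _ _ _ _ _ h_im t Ht).
    exists (Rm u); split; [apply manifold_graph | reflexivity]. }
  rewrite -(manifold_id _ G).
  eapply Rle_trans; [apply manifold_lip |].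
  pose proof (low_error sigma u t sigma_pos mono Qu Ht) as B.
  apply Rle_trans with (3 / 2 * (L * (2 * M / mu * eps ^ 2) / sigma)).
  - apply Rmult_le_compat_l; [lra |].
    eapply Rle_trans; [exact B |].
    apply Rmult_le_compat_r; [apply Rlt_le, Rinv_0_lt_compat, sigma_pos |].
    apply Rmult_le_compat_l; [lra | apply defect_le].
  - right; field; lra.
Qed.

End Comparison.

Theorem theorem6p5
  (H : HilbertSpace) (Hinf : infinite_dimensional H)
  (D : H -> Prop) (A : H -> H)
  (Asa : self_adjoint D A) (Ann : nonnegative D A) (Acr : compact_resolvent D A)
  (F : H -> H) (M L : R) (M_pos : 0 < M) (L_pos : 0 < L)
  (F_bound : forall u, norm (F u) <= M)
  (F_lip : forall u w, norm (minus (F u) (F w)) <= L * norm (minus u w))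
  (mu : R) (mu_pos : 0 < mu)
  (P : R -> H -> H)
  (P_spec : forall eps, 0 < eps <= 1 ->
     is_spectral_projection D A (mu / eps ^ 2) (P eps))
  (T : R -> H -> H) (T_exp : is_exp_semigroup D A T)
  (Teps : R -> R -> H -> H)
  (Teps_exp : forall eps, 0 < eps <= 1 ->
     is_exp_semigroup D (damped A (P eps) eps) (Teps eps))
  (S : R -> H -> H) (S_mild : is_mild_semiflow T F S)
  (Seps : R -> R -> H -> H)
  (Seps_mild : forall eps, 0 < eps <= 1 ->
     is_mild_semiflow (Teps eps) F (Seps eps))
  (h : R -> H -> H)
  (h_im : forall eps, 0 < eps <= 1 -> 8 * L <= gamma D A (P eps) eps ->
     is_inertial_manifold D A F M L eps (P eps) (Seps eps) (h eps))
  (Att : H -> Prop) (Att_S : is_global_attractor S Att)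
  (Atteps : R -> H -> Prop) (eps1 : R) (eps1_range : 0 < eps1 <= 1)
  (Atteps_S : forall eps, 0 < eps <= eps1 ->
     is_global_attractor (Seps eps) (Atteps eps)) :
  let eta_ eps := eta (P eps) (h eps) S (Seps eps) Att (Atteps eps) in
  let d_ eps := defect D A (P eps) M eps in
  let conclusion C0 eps :=
    Rbar_le (hausdorff (Atteps eps) Att) (Rbar_plus (eta_ eps) (d_ eps)) /\
    Rbar_le (Rbar_plus (eta_ eps) (d_ eps)) ((C0 + 2 * M / mu) * eps ^ 2) in
  (* the manifolds, hence all the quantities below, exist for small eps *)
  (exists eps2, 0 < eps2 <= eps1 /\
     forall eps, 0 < eps <= eps2 -> 8 * L <= gamma D A (P eps) eps) /\
  (forall C0 eps2 : R, 0 < eps2 <= eps1 ->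
     (forall eps, 0 < eps <= eps2 -> 8 * L <= gamma D A (P eps) eps ->
        Rbar_le (eta_ eps) (C0 * eps ^ 2)) ->
     forall eps, 0 < eps <= eps2 -> 8 * L <= gamma D A (P eps) eps ->
        conclusion C0 eps) /\
  (forall eps0 sigma : R, 0 < eps0 <= 1 -> 0 < sigma ->
     (forall eps, 0 < eps <= eps0 -> strongly_monotone A F (P eps) sigma) ->
     exists C0 : R, forall eps, 0 < eps <= eps0 -> eps <= eps1 ->
        8 * L <= gamma D A (P eps) eps -> conclusion C0 eps).
Proof.
  intros eta_ d_ conclusion; split; [| split].
  - assert (0 < / (8 * L)) by (apply Rinv_0_lt_compat; lra).
    (* As gamma >= 1 / eps, the gap condition holds once eps <= 1 / (8 L). *)
    exists (Rmin eps1 (/ (8 * L))); split.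
    { split; [apply Rmin_glb_lt; lra | apply Rmin_l]. }
    intros eps [E1 E2].
    pose proof (Rmin_l eps1 (/ (8 * L))); pose proof (Rmin_r eps1 (/ (8 * L))).
    eapply Rle_trans; [| apply (gamma_ge Hinf Asa Ann Acr (mu / eps ^ 2)
      (cutoff_pos mu_pos E1) (P_spec eps ltac:(lra)))].
    rewrite -(Rinv_inv (8 * L)); apply Rinv_le_contravar; lra.
  - intros C0 eps2 E2 Heta eps E gap.
    assert (E' : 0 < eps <= 1) by lra; assert (E1 : 0 < eps <= eps1) by lra.
    exact (attractor_bounds_of_eta Hinf Asa Ann Acr M_pos L_pos F_bound mu_pos (proj1 E)
      (P_spec eps E') T_exp S_mild gap (h_im eps E' gap) Att_S (Atteps_S eps E1) C0
      (Heta eps E gap)).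
  - intros eps0 sigma E0 sigma_pos mono.
    exists (3 * L * M / (sigma * mu)); intros eps E E1 gap.
    assert (E' : 0 < eps <= 1) by lra; assert (E1' : 0 < eps <= eps1) by lra.
    apply (attractor_bounds_of_eta Hinf Asa Ann Acr M_pos L_pos F_bound mu_pos (proj1 E)
      (P_spec eps E') T_exp S_mild gap (h_im eps E' gap) Att_S (Atteps_S eps E1')).
    apply (eta_le_of_strongly_monotone Hinf Asa Ann Acr M_pos L_pos F_bound F_lip mu_pos (proj1 E)
      (P_spec eps E') T_exp (Teps_exp eps E') S_mild (Seps_mild eps E') gap
      (h_im eps E' gap) Att_S (Atteps_S eps E1')); [exact sigma_pos | auto].
Qed.
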